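(* (i) For every $0\le\alpha\le1$, $$\mathcal J_\alpha(\Lambda,\phi_0)(Q)\le\Phi(Q)^{1-\alpha}\Lambda(Q)^\alpha\quad\text{for all }Q\in\mathcal B.$$ (ii) Let $0<\alpha\le1$. Then $$\mathcal N_\alpha(Q)=\alpha\Lambda(Q)+(1-\alpha)\Phi(Q)-\mathcal J_\alpha(\Lambda,\phi_0)(Q)\quad\text{for all }Q\in\mathcal B.$$ (iii) $\mathcal J_\alpha(\Lambda,\phi_0)$ is a finite, $S$-invariant measure on $\mathcal B$ for all $\alpha\in[0,1]$.
   Context: Setting. Let $X$ be a set, $S:X\to X$ a bijection, $\mathcal A$ a $\sigma$-algebra on $X$, $\mathcal A_0$ the $\sigma$-algebra generated by $\bigcup_{i\ge 0}S^{-i}\mathcal A$, $\mathcal B$ the $\sigma$-algebra generated by $\bigcup_{i\in\mathbb Z}S^{-i}\mathcal A$, and $\mathcal A_m:=S^{-m}\mathcal A_0=\{S^{-m}A:A\in\mathcal A_0\}$ for integers $m\le 0$ (so $\mathcal A_0\subset\mathcal A_{-1}\subset\cdots$). Let $\phi_0$ be a finite positive measure on $\mathcal A_0$, and $\Lambda$ a finite positive measure on $\mathcal A_0$ with $\Lambda\circ S^{-1}=\Lambda$ and $\Lambda\ll\phi_0$; let $Z\ge0$ be an $\mathcal A_0$-measurable version of $d\Lambda/d\phi_0$. For $Q\subset X$ let $\mathcal C(Q)$ be the set of all sequences $(A_m)_{m\le0}$ with $A_m\in\mathcal A_m$ for all $m\le 0$ and $Q\subset\bigcup_{m\le0}A_m$.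 Define $\Phi(Q):=\inf_{(A_m)\in\mathcal C(Q)}\sum_{m\le0}\phi_0(S^mA_m)$. The symbol $\Lambda$ also denotes $\Lambda(Q):=\inf_{(A_m)\in\mathcal C(Q)}\sum_{m\le0}\Lambda(S^mA_m)$, $Q\subset X$; its restriction to $\mathcal B$ is the unique $S$-invariant measure on $\mathcal B$ extending $\Lambda$. Conventions: $0\log0:=0$, $y^x:=e^{x\log y}$ and thus $0^0:=1$. For $\epsilon>0$: $\mathcal C^1_\epsilon(Q):=\{(A_m)\in\mathcal C(Q):\sum_{m\le0}\Lambda(S^mA_m)<\Lambda(Q)+\epsilon\}$; $\mathcal C^{0,1}_\epsilon(Q):=\{(A_m)\in\mathcal C^1_\epsilon(Q):\sum_{m\le0}\phi_0(S^mA_m)<\Phi^{\Lambda}(Q)+\epsilon\}$, where $\Phi^{\Lambda}(Q):=\lim_{\epsilon\to0}\inf_{(A_m)\in\mathcal C^1_\epsilon(Q)}\sum_{m\le0}\phi_0(S^mA_m)$ (which equals $\Phi(Q)$). For $\alpha\ge0$: $\mathcal J_\alpha(\Lambda,\phi_0)(Q):=\lim_{\epsilon\to0}\sup_{(A_m)\in\mathcal C^{0,1}_\epsilon(Q)}\sum_{m\le0}\int_{S^mA_m}Z^\alpha d\phi_0$. For $0<\alpha\le1$: $\mathcal N_\alpha(Q):=\lim_{\epsilon\to0}\inf_{(A_m)\in\mathcal C^{0,1}_\epsilon(Q)}\sum_{m\le0}\int_{S^mA_m}(\alpha Z+1-\alpha-Z^\alpha)\,d\phi_0$. *)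

(* Defs.v *)
From HB Require Import structures.
From mathcomp Require Import all_boot all_order all_algebra.
From mathcomp Require Import all_classical all_reals all_analysis.

Set Implicit Arguments.
Unset Strict Implicit.
Unset Printing Implicit Defensive.

Import Order.TTheory GRing.Theory Num.Theory.
Import numFieldNormedType.Exports.

Local Open Scope classical_set_scope.
Local Open Scope ring_scope.

(* The set S^i A for an integer i: forward images for i >= 0, preimages for
   i < 0. For bijective S this is the image of A under the i-th power of S. *)
Definition powset (X : Type) (S : X -> X) (i : int) (A : set X) : set X :=
  match i with
  | Posz n => iter n S @` A
  | Negz n => iter n.+1 S @^-1` A
  end.

Definition gens0 (X : Type) (S : X -> X) (cA : set (set X)) : set (set X) :=
  \bigcup_(i in [set: nat]) [set powset S (- i%:Z) A | A in cA].

Definition gensZ (X : Type) (S : X -> X) (cA : set (set X)) : set (set X) :=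
  \bigcup_(i in [set: int]) [set powset S (- i) A | A in cA].

(* X equipped with the sigma-algebra A_0, resp. B. *)
Notation space0 S cA := (g_sigma_algebraType (gens0 S cA)).
Notation spaceB S cA := (g_sigma_algebraType (gensZ S cA)).

(* Integers m <= 0 are encoded by n : nat with m = - n, throughout. This is the
   sigma-algebra A_m = S^(-m) A_0 for m = - n. *)
Definition sigmam (X : pointedType) (S : X -> X) (cA : set (set X)) (n : nat) :
    set (set X) :=
  [set powset S n%:Z A | A in (measurable : set (set (space0 S cA)))].

(* C(Q); the sequence (A_m)_(m <= 0) is n |-> A_(-n). *)
Definition covers (X : pointedType) (S : X -> X) (cA : set (set X))
    (Q : set X) : set (nat -> set X) :=
  [set A | (forall n, sigmam S cA n (A n)) /\ Q `<=` \bigcup_n A n].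

Local Open Scope ereal_scope.

(* sum over m <= 0 of nu (S^m A_m) *)
Definition dynsum (X : Type) (R : realType) (S : X -> X)
    (nu : set X -> \bar R) (A : nat -> set X) : \bar R :=
  \sum_(0 <= n <oo) nu (powset S (- n%:Z) (A n)).

(* With nu = phi0 this is Phi, with nu = Lambda on A_0 it is the set function
   on all subsets of X that is denoted by Lambda again. *)
Definition dynouter (X : pointedType) (R : realType) (S : X -> X)
    (cA : set (set X)) (nu : set X -> \bar R) (Q : set X) : \bar R :=
  ereal_inf [set dynsum S nu A | A in covers S cA Q].

Definition covers1 (X : pointedType) (R : realType) (S : X -> X)
    (cA : set (set X)) (Lambda : set X -> \bar R) (e : R) (Q : set X) :
    set (nat -> set X) :=
  [set A | covers S cA Q A /\
           dynsum S Lambda A < dynouter S cA Lambda Q + e%:E].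

(* Phi^Lambda *)
Definition dynouter1 (X : pointedType) (R : realType) (S : X -> X)
    (cA : set (set X)) (Lambda phi0 : set X -> \bar R) (Q : set X) : \bar R :=
  lim ((ereal_inf [set dynsum S phi0 A | A in covers1 S cA Lambda e Q])
    @[e --> (0 : R)^'+]).

Definition covers01 (X : pointedType) (R : realType) (S : X -> X)
    (cA : set (set X)) (Lambda phi0 : set X -> \bar R) (e : R) (Q : set X) :
    set (nat -> set X) :=
  [set A | covers1 S cA Lambda e Q A /\
           dynsum S phi0 A < dynouter1 S cA Lambda phi0 Q + e%:E].

(* J_alpha(Lambda, phi0)(Q); note that 0 `^ 0 = 1 for powR. *)
Definition Jfun (X : pointedType) (R : realType) (S : X -> X)
    (cA : set (set X)) (Lambda phi0 : {measure set (space0 S cA) -> \bar R})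
    (Z : X -> R) (alpha : R) (Q : set X) : \bar R :=
  lim ((ereal_sup
      [set dynsum S
             (fun D => \int[phi0]_(x in (D : set (space0 S cA)))
                         (Z x `^ alpha)%:E) A
      | A in covers01 S cA Lambda phi0 e Q])
    @[e --> (0 : R)^'+]).

Definition Nfun (X : pointedType) (R : realType) (S : X -> X)
    (cA : set (set X)) (Lambda phi0 : {measure set (space0 S cA) -> \bar R})
    (Z : X -> R) (alpha : R) (Q : set X) : \bar R :=
  lim ((ereal_inf
      [set dynsum S
             (fun D => \int[phi0]_(x in (D : set (space0 S cA)))
                         (alpha * Z x + 1 - alpha - Z x `^ alpha)%:E) A
      | A in covers01 S cA Lambda phi0 e Q])
    @[e --> (0 : R)^'+]).

(* Main.v *)
(* Every dynamically defined outer measure is generated by an S-invariant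
   measure on A_0.  A set of A_0 lies in all the A_m and so splits every cover:
   Phi restricted to A_0 is a measure nu <= phi_0.  As Phi(S Q) <= Phi(Q),
   passing to complements shows that nu is invariant, and Phi is again the
   outer measure generated by nu.  For an invariant measure the covering sums
   only depend on the increasing unions of the covering sets, so two covers can
   be intersected without raising any of these sums; in particular the outer
   measures generated by invariant measures add up, and covers nearly optimal
   for Phi and for Lambda simultaneously exist.

   Write nu = h phi_0 with 0 <= h <= 1.  The measure
   rho = Z^alpha h^(1-alpha) phi_0 is invariant, because by Young's inequality
   its density is the infimum over rational u of the densities
   alpha e^((1-alpha)u) Z + (1-alpha) e^(-alpha u) h of invariant measures.
   A cover nearly optimal for Phi carries little mass of (1-h) phi_0; by Young's
   inequality again the sums of Z^alpha phi_0 and of rho nearly agree on it.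
   The latter are nearly minimal since alpha Lambda + (1-alpha) nu - rho is
   also an invariant measure.  Hence J_alpha is the outer measure generated by
   rho, and Caratheodory's theorem applies on B. *)
Require Import Defs.
From HB Require Import structures.
From mathcomp Require Import all_boot all_order all_algebra.
From mathcomp Require Import all_classical all_reals all_analysis.
From mathcomp Require Import measurable_realfun ring lra.

Set Implicit Arguments.
Unset Strict Implicit.
Unset Printing Implicit Defensive.

Import Order.TTheory GRing.Theory Num.Theory.
Import numFieldNormedType.Exports.

Local Open Scope classical_set_scope.
Local Open Scope ring_scope.
Local Open Scope ereal_scope.

(** * Dynamically defined outer measures *)

Section dynamical_covers.
Context d (X : measurableType d) (R : realType) (T : X -> X).
Implicit Types (nu : {measure set X -> \bar R}) (Q : set X).
Implicit Types (B : nat -> set X).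

(* The cover (A_m) is encoded by [B n = S^m A_m] in A_0, [m = - n], and [T]
   stands for the inverse of [S], so that [A_m] is [iter n T @^-1` B n]. *)
Definition dcovers Q : set (nat -> set X) :=
  [set B | (forall n, measurable (B n)) /\
           Q `<=` \bigcup_n (iter n T @^-1` B n)].

Definition dcost (nu : set X -> \bar R) B := \sum_(0 <= n <oo) nu (B n).

Definition douter (nu : set X -> \bar R) Q : \bar R :=
  ereal_inf [set dcost nu B | B in dcovers Q].

Lemma dcost_ge0 nu B : 0 <= dcost nu B.
Proof. by apply: nneseries_ge0 => n _ _; exact: measure_ge0. Qed.

Lemma le_dcost (nu1 nu2 : set X -> \bar R) B :
  (forall n, 0 <= nu1 (B n)) -> (forall n, nu1 (B n) <= nu2 (B n)) ->
  dcost nu1 B <= dcost nu2 B.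
Proof. by move=> h0 h; apply: lee_nneseries => // n _; exact: h. Qed.

Lemma dcostS nu B C : (forall n, measurable (B n)) ->
  (forall n, measurable (C n)) -> (forall n, B n `<=` C n) ->
  dcost nu B <= dcost nu C.
Proof.
move=> mB mC BC; apply: lee_nneseries => // n _.
by apply: le_measure => //; rewrite inE.
Qed.

Lemma dcost_single nu E : dcost nu (fun n => if n is 0%N then E else set0) = nu E.
Proof.
rewrite /dcost (nneseries_recl (P := xpredT))// eseries_cond/= eseries0 ?adde0//.
by move=> [|n] //= _ _; rewrite measure0.
Qed.

Lemma douter_le nu Q B : dcovers Q B -> douter nu Q <= dcost nu B.
Proof. by move=> QB; apply: ereal_inf_lbound; exists B. Qed.

Lemma le_douterP nu Q x :
  (forall B, dcovers Q B -> x <= dcost nu B) -> x <= douter nu Q.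
Proof. by move=> h; apply/le_ereal_inf_tmp => _ [B QB <-]; exact: h. Qed.

Lemma douter_ge0 nu Q : 0 <= douter nu Q.
Proof. by apply: le_douterP => B _; exact: dcost_ge0. Qed.

Lemma douter_adherent nu Q (e : R) : (0 < e)%R -> douter nu Q \is a fin_num ->
  exists2 B, dcovers Q B & dcost nu B < douter nu Q + e%:E.
Proof.
by move=> e0 /(lb_ereal_inf_adherent e0)[_ [B QB <-] ?]; exists B.
Qed.

Lemma douter_measurable_le nu E : measurable E -> douter nu E <= nu E.
Proof.
move=> mE; rewrite -dcost_single; apply: douter_le; split; first by case.
by move=> x Ex; exists 0%N.
Qed.

Lemma dcoversS Q Q' B : Q `<=` Q' -> dcovers Q' B -> dcovers Q B.
Proof. by move=> QQ' [mB Q'B]; split => //; exact: subset_trans Q'B. Qed.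

Lemma le_douter nu : {homo douter nu : Q Q' / Q `<=` Q' >-> Q <= Q'}.
Proof.
by move=> Q Q' QQ'; apply: le_douterP => B /(dcoversS QQ'); exact: douter_le.
Qed.

Lemma douter0 nu : douter nu set0 = 0.
Proof.
apply/eqP; rewrite eq_le douter_ge0 andbT.
by rewrite -(measure0 nu); exact: douter_measurable_le.
Qed.

(** Covers of the [A n] with errors e / 2^(n+1) are merged index by index: all sets of index k lie
    in A_0, so their union over n is admissible at index k. *)
Lemma douter_sigma_subadditive nu : sigma_subadditive (douter nu).
Proof.
move=> A; have [[i ioo]|] := pselect (exists i, douter nu (A i) = +oo).
  rewrite (eseries_pinfty _ _ ioo) ?leey// => n _.
  by rewrite -ltNye (lt_le_trans _ (douter_ge0 _ _)).
rewrite -forallNE => Aoo; apply/lee_addgt0Pr => _/posnumP[e].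
rewrite (le_trans _ (epsilon_trick _ _ _))//; last first.
  by move=> n; exact: douter_ge0.
have /choice[G PG] : forall n, exists B, dcovers (A n) B /\
    dcost nu B <= douter nu (A n) + (e%:num / (2 ^ n.+1)%:R)%:E.
  move=> n; have [||B AB /ltW] := @douter_adherent nu (A n) (e%:num / (2 ^ n.+1)%:R).
  - by [].
  - by rewrite ge0_fin_numE ?douter_ge0// ltey; exact/eqP.
  by exists B.
pose H k := \bigcup_n G n k.
have mH k : measurable (H k).
  by apply: bigcup_measurable => n _; exact: (PG n).1.1.
apply: (@le_trans _ _ (dcost nu H)).
  apply: douter_le; split => // x [n _ /((PG n).1.2)[k _ Gx]].
  by exists k => //; exists n.
apply: (@le_trans _ _ (\sum_(k <oo) \sum_(n <oo) nu (G n k))).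
  apply: lee_nneseries => // k _; apply: measure_sigma_subadditive => //.
  by move=> n; exact: (PG n).1.1.
rewrite nneseries_interchange//.
apply: lee_nneseries => [n _ _|n _]; first exact: nneseries_ge0.
exact: (PG n).2.
Qed.

HB.instance Definition _ nu := isOuterMeasure.Build R X (douter nu)
  (douter0 nu) (douter_ge0 nu) (le_douter nu) (douter_sigma_subadditive nu).

(* The converse inequality fails for individual covers: it would need
   [nu (S @^-1` B 0) <= nu (B 0)]. *)
Lemma douter_shift_le nu Q : douter nu (T @^-1` Q) <= douter nu Q.
Proof.
apply: le_douterP => B [mB QB].
(* Delaying the cover by one index, with the empty set in front, keeps the sum and covers the
   preimage of [Q] under [T]. *)
rewrite (_ : dcost nu B = dcost nu (fun n => if n is k.+1 then B k else set0)).
  apply: douter_le; split => [[]//|x /QB[n _ Bx]].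
  by exists n.+1 => //=; rewrite /preimage/= -iterSr in Bx *.
rewrite {2}/dcost (nneseries_recl (P := xpredT))//= measure0 add0e.
rewrite -nneseries_addn; last by case.
by apply: eq_eseriesr => n _; rewrite addn1.
Qed.

Lemma douter_iter_le nu Q n : douter nu (iter n T @^-1` Q) <= douter nu Q.
Proof.
elim: n Q => [//|n ih] Q.
apply: (le_trans _ (ih Q)).
rewrite (_ : iter n.+1 T @^-1` Q = T @^-1` (iter n T @^-1` Q)).
  exact: douter_shift_le.
by apply/seteqP; split => x; rewrite /preimage/= -iterSr.
Qed.

End dynamical_covers.

(** * Construction of finite measures *)

Section finite_measures_from_set_functions.
Context d (Y : measurableType d) (R : realType).

Section of_set_function.
Variable m : set Y -> \bar R.
Hypotheses (m0 : m set0 = 0) (m_ge0 : forall A, 0 <= m A).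
Hypotheses (m_additive : semi_sigma_additive m) (m_fin : m setT < +oo).

Let mu : set Y -> \bar R := m.

HB.instance Definition _ := isMeasure.Build _ _ _ mu m0 m_ge0 m_additive.

Let mu_fin : fin_num_fun mu.
Proof.
move=> A mA; rewrite ge0_fin_numE//; apply: le_lt_trans m_fin.
by apply: (le_measure mu); rewrite ?inE.
Qed.

HB.instance Definition _ := Measure_isFinite.Build _ _ _ mu mu_fin.

Lemma finite_measure_of_set_function :
  exists mu : {finite_measure set Y -> \bar R}, forall A, mu A = m A.
Proof. by exists mu. Qed.

End of_set_function.

(** The sigma-algebra of [Y] only has to lie inside the Caratheodory sets, so this serves both A_0
    and B. *)
Lemma caratheodory_finite_measure (mu : {outer_measure set Y -> \bar R}) :
  (forall E, measurable E -> mu.-caratheodory E) -> mu setT < +oo ->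
  exists m : {finite_measure set Y -> \bar R}, forall A, m A = mu A.
Proof.
move=> muE muT; apply: (finite_measure_of_set_function (outer_measure0 _)
  (outer_measure_ge0 _) _ muT).
move=> F mF tF _.
have -> : mu (\bigcup_n F n) = \sum_(n <oo) mu (F n).
  apply/eqP; rewrite eq_le outer_measure_sigma_subadditive/=.
  (* The union itself is the test set, so the part outside it is empty. *)
  have := @caratheodory_lime_le _ _ mu F (fun n => muE _ (mF n)) tF (\bigcup_n F n).
  rewrite setICr outer_measure0 adde0; congr (_ <= _).
  by apply: eq_eseriesr => n _; congr (mu _); apply/setIidPr; exact: bigcup_sup.
by apply: is_cvg_nneseries => n _ _; exact: outer_measure_ge0.
Qed.

Lemma density_finite_measure (phi : {measure set Y -> \bar R}) (f : Y -> R) :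
  measurable_fun setT f -> (forall x, 0 <= f x)%R ->
  \int[phi]_x (f x)%:E < +oo ->
  exists mu : {finite_measure set Y -> \bar R},
    forall A, mu A = \int[phi]_(x in A) (f x)%:E.
Proof.
move=> mf f0 foo.
apply: (@finite_measure_of_set_function (fun A => \int[phi]_(x in A) (f x)%:E)) => //.
- exact: integral_set0.
- by move=> A; apply: integral_ge0 => x _; rewrite lee_fin.
- apply: semi_sigma_additive_nng_induced; first exact/measurable_EFinP.
  by move=> x; rewrite lee_fin.
Qed.

End finite_measures_from_set_functions.

Lemma finite_measureC d (X : measurableType d) (R : realType)
    (mu : {finite_measure set X -> \bar R}) A :
  measurable A -> mu (~` A) = mu setT - mu A.
Proof.
move=> mA; rewrite -setTD measureD// ?setTI//.
by rewrite -ge0_fin_numE// fin_num_measure.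
Qed.

Lemma iter_can (X : Type) (f g : X -> X) n :
  cancel f g -> cancel (iter n f) (iter n g).
Proof. by move=> fg; elim: n => // n ih x; rewrite iterSr /= fg ih. Qed.

(** * Covers and shift-invariant measures *)

Section bijective_shift.
Context d (X : measurableType d) (R : realType) (S T : X -> X).
Hypotheses (SK : cancel S T) (TK : cancel T S) (mS : measurable_fun setT S).
Implicit Types (nu mu : {finite_measure set X -> \bar R}) (Q E : set X).

Lemma measurable_preimage_iter n E :
  measurable E -> measurable (iter n S @^-1` E).
Proof.
move=> mE; elim: n => //= n ih.
rewrite (_ : _ @^-1` _ = S @^-1` (iter n S @^-1` E)).
  by rewrite -[X in measurable X]setTI; exact: mS.
by apply/seteqP; split => x /=; rewrite -iterSr.
Qed.

Lemma preimage_iterTK n E : iter n T @^-1` (iter n S @^-1` E) = E.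
Proof. by apply/seteqP; split=> x; rewrite /preimage/= (iter_can _ TK). Qed.

Lemma preimage_iterSK n E : iter n S @^-1` (iter n T @^-1` E) = E.
Proof. by apply/seteqP; split=> x; rewrite /preimage/= (iter_can _ SK). Qed.

Lemma douter_lty nu Q : douter T nu Q < +oo.
Proof.
apply: (@le_lt_trans _ _ (nu setT)); last by rewrite ltey_eq fin_num_measure.
exact: le_trans (le_douter _ _ (@subsetT _ Q)) (douter_measurable_le _ _ _).
Qed.

Lemma douter_fin_num nu Q : douter T nu Q \is a fin_num.
Proof. by rewrite ge0_fin_numE ?douter_ge0// douter_lty. Qed.

Lemma dcost_split (nu : {measure set X -> \bar R}) B C D :
  (forall n, measurable (B n)) -> (forall n, measurable (C n)) ->
  (forall n, D n = B n `\` C n) -> 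
  dcost nu B = dcost nu (fun n => B n `&` C n) + dcost nu D.
Proof.
move=> mB mC DE; rewrite -nneseriesD//; apply: eq_eseriesr => n _.
rewrite DE addeC; exact: measureDI.
Qed.

(** As A_0 is contained in every A_m, [E] splits each set of a cover of [Q] within A_m. This gives
    covers of the two parts of [Q] whose sums add up to the original one. *)
Lemma douter_caratheodory (nu : {measure set X -> \bar R}) E :
  measurable E -> (douter T nu : {outer_measure set X -> \bar R}).-caratheodory E.
Proof.
move=> mE; apply: le_caratheodory_measurable => Q /=.
apply: le_douterP => B [mB QB].
have mSE n := measurable_preimage_iter n mE.
rewrite (@dcost_split nu B (fun n => iter n S @^-1` E)
  (fun n => B n `\` iter n S @^-1` E))//.
apply: leeD; apply: douter_le; split.
- by move=> n; exact: measurableI.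
- move=> x [/QB[n _ Bx] Ex]; exists n => //; split => //.
  by rewrite /preimage/= (iter_can _ TK).
- by move=> n; exact: measurableD.
- move=> x [/QB[n _ Bx] Ex]; exists n => //; split => //.
  by rewrite /preimage/= (iter_can _ TK).
Qed.

(** * Invariant measures and the restriction of the outer measure to A_0 *)

Definition shift_invariant (mu : set X -> \bar R) :=
  forall A, measurable A -> mu (S @^-1` A) = mu A.

Lemma shift_invariant_iter (mu : set X -> \bar R) n A : shift_invariant mu ->
  measurable A -> mu (iter n S @^-1` A) = mu A.
Proof.
move=> muS mA; elim: n => // n ih.
rewrite (_ : iter n.+1 S @^-1` A = S @^-1` (iter n S @^-1` A)).
  by rewrite muS//; exact: measurable_preimage_iter.
by apply/seteqP; split => x; rewrite /preimage/= -iterSr.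
Qed.

(** Subtracted from the finite total mass, the hypothesis for the complement of [A] is the reverse
    inequality for [A]. *)
Lemma le_shift_invariant mu :
  (forall A, measurable A -> mu A <= mu (S @^-1` A)) -> shift_invariant mu.
Proof.
move=> muS A mA; apply/eqP; rewrite eq_le muS// andbT.
have mSA : measurable (S @^-1` A) by exact: (measurable_preimage_iter 1 mA).
have := muS _ (measurableC mA); rewrite -preimage_setC.
by rewrite !finite_measureC// leeD2lE ?fin_num_measure// leeN2.
Qed.

Lemma ge_shift_invariant mu :
  (forall A, measurable A -> mu (S @^-1` A) <= mu A) -> shift_invariant mu.
Proof.
move=> muS; apply: le_shift_invariant => A mA.
have mSA : measurable (S @^-1` A) by exact: (measurable_preimage_iter 1 mA).
have := muS _ (measurableC mA); rewrite -preimage_setC.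
by rewrite !finite_measureC// leeD2lE ?fin_num_measure// leeN2.
Qed.

Lemma douter_restriction nu :
  exists mu, [/\ forall A, mu A = douter T nu A, shift_invariant mu &
                 forall A, measurable A -> mu A <= nu A].
Proof.
have [mu muE] := caratheodory_finite_measure
  (fun E mE => douter_caratheodory nu mE) (douter_lty nu setT).
exists mu; split=> //.
  apply: le_shift_invariant => A mA; rewrite !muE.
  by rewrite -[in leLHS](preimage_iterTK 1 A)/=; exact: douter_shift_le.
by move=> A mA; rewrite muE; exact: douter_measurable_le.
Qed.

(** One inequality comes from [mu <= nu] on A_0. For the other, the piece of index n of a cover is
    the preimage of [B n] under [iter n T], whose outer measure is at most that of [B n], which is
    [mu (B n)]. *)
Lemma douter_idem nu mu : (forall A, mu A = douter T nu A) ->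
  forall Q, douter T mu Q = douter T nu Q.
Proof.
move=> muE Q; apply/eqP; rewrite eq_le; apply/andP; split.
  apply: le_douterP => B QB; apply: le_trans (douter_le _ QB) _.
  apply: le_dcost => n //=.
  by rewrite muE; apply: douter_measurable_le (QB.1 n).
apply: le_douterP => B [mB QB].
apply: (le_trans (le_douter T nu QB)).
apply: (le_trans (douter_sigma_subadditive T nu _)).
apply: lee_nneseries => [n _ _|n _]; first exact: douter_ge0.
by rewrite /= muE; exact: douter_iter_le.
Qed.


(** * Covers described by their increasing unions *)

Definition layer (U : nat -> set X) n :=
  if n is k.+1 then U k.+1 `\` S @^-1` U k else U 0%N.

(** Let V_n be the preimage of [U n] under [iter n T]. The second condition says that V_n increases
    with n, and [layer U] encodes the differences of consecutive V_n. *)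
Definition exhaustion Q (U : nat -> set X) :=
  [/\ forall n, measurable (U n), forall n, S @^-1` U n `<=` U n.+1 &
      Q `<=` \bigcup_n (iter n T @^-1` U n)].

Lemma measurable_preimageS E : measurable E -> measurable (S @^-1` E).
Proof. exact: (measurable_preimage_iter 1). Qed.

Lemma measurable_layer Q U n : exhaustion Q U -> measurable (layer U n).
Proof.
case=> mU _ _; case: n => [|n] //=.
by apply: measurableD => //; exact: measurable_preimageS.
Qed.

(** A point lies in the layer of the first index at which it enters the exhaustion; the induction
    descends to that index. *)
Lemma dcovers_layer Q U : exhaustion Q U -> dcovers T Q (layer U).
Proof.
move=> QU; split=> [n|x]; first exact: measurable_layer QU.
case: QU => _ _ /[apply] -[n _]; elim: n => [|n ih] Ux; first by exists 0%N.
have [UTx|nUTx] := pselect (U n (S (iter n.+1 T x))); last by exists n.+1.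
by apply: ih; rewrite /preimage/= -(TK (iter n T x)).
Qed.

(** By invariance the set removed from [U n.+1] has the mass of [U n], so the sum telescopes.
    Invariant sums over layers thus see only the unions. *)
Lemma sum_layer (mu : {measure set X -> \bar R}) Q U n : shift_invariant mu ->
  exhaustion Q U -> \sum_(0 <= i < n.+1) mu (layer U i) = mu (U n).
Proof.
move=> muS QU; elim: n => [|n ih]; first by rewrite big_nat1.
have [mU SU _] := QU.
rewrite big_nat_recr//= ih -(muS (U n))//.
have mSU := measurable_preimageS (mU n).
rewrite (measureDI mu (mU n.+1) mSU) addeC; congr (_ + mu _).
by rewrite setIC; apply/esym/setIidPl; exact: SU.
Qed.

Lemma dcost_layer_le (mu : {measure set X -> \bar R}) Q U M : shift_invariant mu ->
  exhaustion Q U -> (forall n, mu (U n) <= M) -> dcost mu (layer U) <= M.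
Proof.
move=> muS QU UM; apply: lime_le; first exact: is_cvg_nneseries.
apply: nearW => -[|n]; last by rewrite (sum_layer _ muS QU).
by rewrite big_geq//; exact: le_trans (UM 0%N).
Qed.

Lemma exhaustionI Q U V : exhaustion Q U -> exhaustion Q V ->
  exhaustion Q (fun n => U n `&` V n).
Proof.
(* An exhaustion keeps every point it has reached; hence a point reached at n by one and at k by the
   other lies in both at n + k. *)
have mono W : (forall n, S @^-1` W n `<=` W n.+1) -> forall x n k,
    W n (iter n T x) -> W (k + n)%N (iter (k + n)%N T x).
  move=> SW x n k Wx; elim: k => // k ih.
  by rewrite addSn; apply: SW; rewrite /preimage/= TK.
case=> mU SU QU [mV SV QV]; split=> [n|n x [/SU ? /SV]//|x Qx].
  exact: measurableI.
have [n _ Ux] := QU _ Qx; have [k _ Vx] := QV _ Qx.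
exists (n + k)%N => //; split; last exact: mono.
by rewrite /preimage addnC; exact: mono.
Qed.

(** The union of the first n + 1 sets of the cover, in the coordinates of index n. *)
Fixpoint cumulated (B : nat -> set X) n :=
  if n is k.+1 then S @^-1` cumulated B k `|` B k.+1 else B 0%N.

Lemma exhaustion_cumulated Q B : dcovers T Q B -> exhaustion Q (cumulated B).
Proof.
move=> [mB QB]; split=> [|n|].
- by elim=> //= n ih; apply: measurableU => //; exact: measurable_preimageS.
- exact: subsetUl.
- by move=> x /QB[[|n] _ Bx]; [exists 0%N|exists n.+1 => //; right].
Qed.

Lemma cumulated_le_dcost (mu : {measure set X -> \bar R}) Q B n :
  shift_invariant mu -> dcovers T Q B -> mu (cumulated B n) <= dcost mu B.
Proof.
move=> muS QB; have [mU _ _] := exhaustion_cumulated QB.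
apply: (@le_trans _ _ (\sum_(0 <= i < n.+1) mu (B i))); last first.
  by apply: nneseries_lim_ge => i _.
elim: n => [|n ih]; first by rewrite big_nat1.
rewrite big_nat_recr//=; apply: le_trans (leeD2r _ ih).
rewrite -(muS (cumulated B n))//; apply: measureU2; last exact: QB.1.
exact: measurable_preimageS.
Qed.

Lemma layer_cumulated_sub B n : layer (cumulated B) n `<=` B n.
Proof. by case: n => [//|n x /= [[]]]. Qed.

(** The increasing unions of both covers are intersected and cut into layers. The resulting [C]
    serves all invariant measures at once, since their sums over it are bounded by masses of
    unions. *)
Lemma common_dcover Q B1 B2 : dcovers T Q B1 -> dcovers T Q B2 ->
  exists2 C, dcovers T Q C &
    forall mu : {measure set X -> \bar R}, shift_invariant mu ->
      dcost mu C <= dcost mu B1 /\ dcost mu C <= dcost mu B2.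
Proof.
move=> QB1 QB2.
have QU1 := exhaustion_cumulated QB1; have QU2 := exhaustion_cumulated QB2.
have [mU1 _ _] := QU1; have [mU2 _ _] := QU2.
have QU := exhaustionI QU1 QU2.
exists (layer (fun n => cumulated B1 n `&` cumulated B2 n)).
  exact: dcovers_layer.
move=> mu muS; split; apply: (dcost_layer_le muS QU) => n.
- apply: le_trans (cumulated_le_dcost n muS QB1).
  by apply: le_measure; rewrite ?inE//; exact: measurableI.
- apply: le_trans (cumulated_le_dcost n muS QB2).
  by apply: le_measure; rewrite ?inE//; exact: measurableI.
Qed.

(** The cover is cut down to [E] and then made disjoint. The layers are subsets of the sets of [B],
    which bounds the [nu]-sum; the unions stay inside [E], which bounds the invariant sum. *)
Lemma dcover_within (nu mu : {measure set X -> \bar R}) E B :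
  shift_invariant mu -> measurable E -> dcovers T E B ->
  exists2 C, dcovers T E C & dcost nu C <= dcost nu B /\ dcost mu C <= mu E.
Proof.
move=> muS mE [mB EB].
pose B' n := B n `&` iter n S @^-1` E.
have mSE n := measurable_preimage_iter n mE.
have EB' : dcovers T E B'.
  split=> [n|x Ex]; first exact: measurableI.
  have [n _ Bx] := EB _ Ex; exists n => //; split => //.
  by rewrite /preimage/= (iter_can _ TK).
have EU := exhaustion_cumulated EB'; have [mU _ _] := EU.
exists (layer (cumulated B')); first exact: dcovers_layer.
split.
  apply: dcostS => // n; first exact: measurable_layer EU.
  by move=> x /layer_cumulated_sub [].
apply: (dcost_layer_le muS EU) => n.
rewrite -(shift_invariant_iter n muS mE).
apply: le_measure; rewrite ?inE//.
elim: n => [x []//|n ih x /= [/ih|[]//]].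
by rewrite /preimage/= -iterSr.
Qed.

(** * Sums of measures and simultaneously nearly optimal covers *)

Lemma dcostD (mu1 mu2 mu : {measure set X -> \bar R}) B :
  (forall A, measurable A -> mu A = mu1 A + mu2 A) ->
  (forall n, measurable (B n)) ->
  dcost mu B = dcost mu1 B + dcost mu2 B.
Proof.
by move=> muE mB; rewrite -nneseriesD//; apply: eq_eseriesr => n _; rewrite muE.
Qed.

Lemma douter_shift mu Q : shift_invariant mu ->
  douter T mu (S @^-1` Q) = douter T mu Q.
Proof.
move=> muS; apply/eqP; rewrite eq_le; apply/andP; split.
  apply: le_douterP => B [mB QB].
  rewrite (_ : dcost mu B = dcost mu (fun n => S @^-1` B n)).
    apply: douter_le; split=> [n|x /QB[n _ Bx]].
      exact: measurable_preimageS.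
    exists n => //; rewrite /preimage/=.
    suff <- : iter n T (S x) = S (iter n T x) by [].
    by case: n {Bx} => // n; rewrite iterSr SK iterS TK.
  by apply: eq_eseriesr => n _; rewrite muS.
by rewrite -[in leLHS](preimage_iterTK 1 Q)/=; exact: douter_shift_le.
Qed.

Lemma douter_shift_iter mu n Q : shift_invariant mu ->
  douter T mu (iter n S @^-1` Q) = douter T mu Q.
Proof.
move=> muS; elim: n => // n ih.
rewrite (_ : iter n.+1 S @^-1` Q = S @^-1` (iter n S @^-1` Q)).
  by rewrite douter_shift.
by apply/seteqP; split => x; rewrite /preimage/= -iterSr.
Qed.

(** Among the generators of B are images under positive powers of [S], which need not lie in A_0. By
    invariance the whole splitting identity may be pulled back by [iter n S], which leads back to
    [E] in A_0. *)
Lemma douter_invariant_caratheodory mu n E : shift_invariant mu ->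
  measurable E ->
  (douter T mu : {outer_measure set X -> \bar R}).-caratheodory (iter n T @^-1` E).
Proof.
move=> muS mE Q /=; have shiftE := douter_shift_iter n _ muS.
rewrite -(shiftE Q) -(shiftE (Q `&` _)) -(shiftE (Q `&` ~` _)).
rewrite (douter_caratheodory mu mE) /=.
by rewrite !preimage_setI -[iter n S @^-1` (~` _)]preimage_setC preimage_iterSK.
Qed.

(* A cover of a set [E] of A_0 chosen for [nu] can be shrunk into [E], which
   does not make its [mu]-sum exceed [mu E]. *)
Lemma douterD_le nu mu (psi : {finite_measure set X -> \bar R}) Q :
  shift_invariant mu -> (forall A, measurable A -> psi A = nu A + mu A) ->
  douter T psi Q <= douter T nu Q + douter T mu Q.
Proof.
move=> muS psiE.
have [rho [rhoE rhoS _]] := douter_restriction nu.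
have psi_le E : measurable E -> douter T psi E <= douter T nu E + mu E.
  move=> mE; apply/lee_addgt0Pr => e e0.
  have [B EB Be] := douter_adherent e0 (douter_fin_num nu E).
  have [C EC [CB CE]] := dcover_within nu muS mE EB.
  apply: (le_trans (douter_le psi EC)); rewrite (dcostD psiE EC.1).
  by rewrite addeAC leeD//; exact: le_trans CB (ltW Be).
(* [nu] is replaced by the invariant [rho] with the same outer measure, so that [common_dcover]
   bounds both sums. *)
rewrite -(douter_idem rhoE).
apply/lee_addgt0Pr => e e0; have e20 : (0 < e / 2)%R by rewrite divr_gt0.
have [B1 QB1 B1e] := douter_adherent e20 (douter_fin_num rho Q).
have [B2 QB2 B2e] := douter_adherent e20 (douter_fin_num mu Q).
have [C QC Cle] := common_dcover QB1 QB2.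
apply: (le_trans (le_douter T psi QC.2)).
apply: (le_trans (douter_sigma_subadditive T psi _)).
apply: (@le_trans _ _ (dcost rho C + dcost mu C)).
  rewrite -nneseriesD//; apply: lee_nneseries => [n _ _|n _].
    exact: douter_ge0.
  rewrite rhoE; apply: le_trans (douter_iter_le _ _ _ _) _.
  exact: psi_le (QC.1 n).
rewrite [in leRHS](splitr e) EFinD addeACA.
by apply: leeD; [apply: le_trans (ltW B1e); case: (Cle _ rhoS)
                |apply: le_trans (ltW B2e); case: (Cle _ muS)].
Qed.

(** A cover nearly optimal for [nu + mu] exceeds the sum of the two infima by less than e. Neither
    sum is below its infimum, so each exceeds its own by less than e. *)
Lemma good_dcover nu mu Q (e : R) : shift_invariant mu -> (0 < e)%R ->
  exists2 B, dcovers T Q B & dcost nu B < douter T nu Q + e%:E /\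
                             dcost mu B < douter T mu Q + e%:E.
Proof.
move=> muS e0.
have [psi psiE] : exists psi : {finite_measure set X -> \bar R},
    forall A, psi A = measure_add nu mu A.
  apply: (@finite_measure_of_set_function _ _ _ (measure_add nu mu)).
  - by rewrite measure_addE !measure0 adde0.
  - by move=> A; rewrite measure_addE adde_ge0.
  - by rewrite /measure_add; exact: measure_semi_sigma_additive.
  rewrite measure_addE ltey_eq fin_numD.
  by rewrite (fin_num_measure nu _ measurableT) (fin_num_measure mu _ measurableT).
have {}psiE A : measurable A -> psi A = nu A + mu A.
  by move=> _; rewrite psiE measure_addE.
have [B QB] := douter_adherent e0 (douter_fin_num psi Q).
rewrite (dcostD psiE QB.1) => /lt_le_trans/(_ (leeD2r e%:E (douterD_le Q muS psiE))) sum_lt.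
exists B => //; move: sum_lt (douter_le nu QB) (douter_le mu QB).
rewrite -(fineK (douter_fin_num nu Q)) -(fineK (douter_fin_num mu Q)).
move: (dcost_ge0 mu B) (dcost_ge0 nu B).
case: (dcost nu B) (dcost mu B) => [a||] [b||] //.
by rewrite -!EFinD !lte_fin !lee_fin => *; split; lra.
Qed.

End bijective_shift.

(** * Young's inequality with a parameter *)

Section weighted_mean.
Context (R : realType).
Local Open Scope ring_scope.
Implicit Types (a u x y : R).

(** The arithmetic mean, with weights a and 1 - a, of e^((1-a)u) x and e^(-au) y, whose geometric
    mean is x^a y^(1-a) for every u. Being linear in x and y, it carries over to measures. *)
Definition weighted_sum a u x y : R :=
  a * expR ((1 - a) * u) * x + (1 - a) * expR (- (a * u)) * y.

Lemma weighted_sum_ge0 a u x y : 0 <= a <= 1 -> 0 <= x -> 0 <= y ->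
  0 <= weighted_sum a u x y.
Proof.
move=> /andP[a0 a1] x0 y0.
by rewrite addr_ge0// !mulr_ge0// ?expR_ge0// subr_ge0.
Qed.

Lemma powR_le_weighted_sum a u x y : 0 <= a <= 1 -> 0 <= x -> 0 <= y ->
  x `^ a * y `^ (1 - a) <= weighted_sum a u x y.
Proof.
move=> a01 x0 y0; have ws0 := weighted_sum_ge0 u a01 x0 y0.
have /andP[a0 a1] := a01.
(* Endpoint exponents and zero arguments are separated because of 0^0 = 1 and the logarithms
   below. *)
have [->|a_neq0] := eqVneq a 0.
  by rewrite /weighted_sum powRr0 !(mul0r, mul1r, subr0, oppr0, expR0, add0r) powRr1.
have [->|a_neq1] := eqVneq a 1.
  by rewrite /weighted_sum subrr powRr0 !(mul0r, mul1r, expR0, addr0, mulr1) powRr1.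
have [x_eq0|x_neq0] := eqVneq x 0; first by rewrite {1}x_eq0 powR0// mul0r.
have [y_eq0|y_neq0] := eqVneq y 0.
  by rewrite {1}y_eq0 powR0 ?mulr0// subr_eq0 eq_sym.
have [p ->] : exists p, x = expR p.
  by exists (ln x); rewrite lnK// posrE lt_neqAle eq_sym x_neq0.
have [q ->] : exists q, y = expR q.
  by exists (ln y); rewrite lnK// posrE lt_neqAle eq_sym y_neq0.
rewrite -!expRM -expRD /weighted_sum -!mulrA -!expRD.
set m := p * a + _.
rewrite (_ : (1 - a) * u + p = m + (1 - a) * (p + u - q)); last by rewrite /m; ring.
rewrite (_ : - (a * u) + q = m + - (a * (p + u - q))); last by rewrite /m; ring.
rewrite [in leRHS]expRD [X in _ <= _ + _ * X]expRD.
set t := p + u - q.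
(* In the bounds 1 + s <= e^s for the two exponentials, the linear terms cancel after weighting. *)
have e1 := expR_ge1Dx ((1 - a) * t); have e2 := expR_ge1Dx (- (a * t)).
have -> : a * (expR m * expR ((1 - a) * t)) +
   (1 - a) * (expR m * expR (- (a * t))) =
   expR m * (a * expR ((1 - a) * t) + (1 - a) * expR (- (a * t))) by ring.
rewrite ler_peMr ?expR_ge0//.
have b0 : 0 <= 1 - a by rewrite subr_ge0.
have := lerD (ler_wpM2l a0 e1) (ler_wpM2l b0 e2).
by apply: le_trans; rewrite le_eqVlt; apply/orP; left; apply/eqP; ring.
Qed.

Lemma weighted_sum_continuous a x y : continuous (fun u => weighted_sum a u x y).
Proof.
have expR_comp (f : R -> R) v : {for v, continuous f} ->
    {for v, continuous (fun w => expR (f w))}.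
  by move=> fv; apply: continuous_comp => //; exact: continuous_expR.
move=> u; apply: cvgD; apply: cvgMl; apply: cvgMr.
  apply: (expR_comp (fun v => (1 - a) * v) u).
  by apply: cvgMr; exact: cvg_id.
apply: (expR_comp (fun v => - (a * v)) u).
by apply: cvgN; apply: cvgMr; exact: cvg_id.
Qed.

Lemma weighted_sum_adherent a x y (e : R) : 0 <= a <= 1 -> 0 <= x -> 0 <= y ->
  0 < e -> exists u, weighted_sum a u x y < x `^ a * y `^ (1 - a) + e.
Proof.
move=> /andP[a0 a1] x0 y0 e0.
have [->|a_neq0] := eqVneq a 0.
  exists 0; rewrite /weighted_sum powRr0.
  by rewrite !(mul0r, mul1r, subr0, oppr0, expR0, add0r) powRr1// ltrDl.
have [->|a_neq1] := eqVneq a 1.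
  exists 0; rewrite /weighted_sum subrr powRr0.
  by rewrite !(mul0r, mul1r, expR0, addr0, mulr1) powRr1// ltrDl.
have {a_neq0}a_gt0 : 0 < a by rewrite lt_neqAle eq_sym a_neq0.
have {a_neq1}a_lt1 : 0 < 1 - a by rewrite subr_gt0 lt_neqAle a_neq1.
have small (z : R) : 0 <= z -> z * (e / (z + 1)) < e.
  move=> z0; have z1 : 0 < z + 1 by lra.
  by rewrite mulrCA gtr_pMr// ltr_pdivrMr// mul1r; lra.
have eP (z : R) : 0 <= z -> expR (ln (e / (z + 1))) = e / (z + 1).
  by move=> z0; rewrite lnK// posrE divr_gt0//; lra.
have [->|x_neq0] := eqVneq x 0.
  (* For x = 0 a large u is needed: this one makes e^(-au) equal to e / (y + 1), where the 1 guards
     against y = 0. *)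
  exists (- ln (e / (y + 1)) / a); rewrite /weighted_sum powR0 ?gt_eqF//.
  rewrite mulr0 mul0r !add0r mulrC (mulrC a) mulfVK ?gt_eqF// opprK eP//.
  rewrite mulrCA; apply: le_lt_trans (small _ y0).
  by rewrite ler_piMl//; [rewrite mulr_ge0// divr_ge0//; lra|lra].
have [->|y_neq0] := eqVneq y 0.
  (* For y = 0 it is e^((1-a)u) that has to be small. *)
  exists (ln (e / (x + 1)) / (1 - a)).
  rewrite /weighted_sum [X in _ * X + e]powR0 ?gt_eqF//.
  rewrite !mulr0 addr0 add0r (mulrC (1 - a)) mulfVK ?gt_eqF// eP//.
  apply: le_lt_trans (small _ x0); set t := e / (x + 1).
  have t0 : 0 <= t by rewrite divr_ge0//; lra.
  by rewrite -mulrA (mulrC t) ler_piMl//; exact: mulr_ge0.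
have [p ->] : exists p, x = expR p.
  by exists (ln x); rewrite lnK// posrE lt_neqAle eq_sym x_neq0.
have [q ->] : exists q, y = expR q.
  by exists (ln y); rewrite lnK// posrE lt_neqAle eq_sym y_neq0.
(* The case of equality: u = log y - log x makes the two averaged numbers equal. *)
exists (q - p); rewrite -!expRM -expRD /weighted_sum -!mulrA -!expRD.
rewrite (_ : (1 - a) * (q - p) + p = p * a + q * (1 - a)); last by ring.
rewrite (_ : - (a * (q - p)) + q = p * a + q * (1 - a)); last by ring.
by rewrite -mulrDl addrC subrK mul1r ltrDl.
Qed.

(** Rational parameters leave only countably many densities, as a countable decomposition of the
    space requires. *)
Lemma weighted_sum_rat_adherent a x y (e : R) : 0 <= a <= 1 -> 0 <= x ->
  0 <= y -> 0 < e ->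
  exists r : rat, weighted_sum a (ratr r) x y < x `^ a * y `^ (1 - a) + e.
Proof.
move=> a01 x0 y0 e0; have [u ue] := weighted_sum_adherent a01 x0 y0 e0.
set c := (X in _ < X) in ue *.
have oc : open [set v | weighted_sum a v x y < c].
  apply: (open_comp (f := fun v => weighted_sum a v x y) (D := [set z | z < c])).
    by move=> v _; exact: weighted_sum_continuous.
  exact: open_lt.
have [v [ /= vc [r _ rE]]] := dense_rat (ex_intro _ u ue) oc.
by exists r; rewrite rE.
Qed.

End weighted_mean.

Lemma measurable_set_ltr d (X : measurableType d) (R : realType) (f g : X -> R) :
  measurable_fun setT f -> measurable_fun setT g ->
  measurable [set x | f x < g x]%R.
Proof.
move=> mf mg; rewrite -[X in measurable X]setTI -preimage_true.
by apply: measurable_fun_ltr.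
Qed.

(** * Measures given by densities *)

Section densities.
Context d (X : measurableType d) (R : realType).
Variable phi : {measure set X -> \bar R}.
Implicit Types (f g : X -> R) (A : set X).

Lemma le_integral_density f g A : measurable A ->
  measurable_fun setT f -> measurable_fun setT g ->
  (forall x, 0 <= f x)%R -> (forall x, A x -> f x <= g x)%R ->
  \int[phi]_(x in A) (f x)%:E <= \int[phi]_(x in A) (g x)%:E.
Proof.
move=> mA mf mg f0 fg; apply: ge0_le_integral => //.
- by move=> x _; rewrite lee_fin.
- by apply/measurable_EFinP; exact: measurable_funTS.
- by apply/measurable_EFinP; exact: measurable_funTS.
Qed.

Lemma integral_densityD f g A : measurable A ->
  measurable_fun setT f -> measurable_fun setT g ->
  (forall x, 0 <= f x)%R -> (forall x, 0 <= g x)%R ->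
  \int[phi]_(x in A) (f x + g x)%:E =
  \int[phi]_(x in A) (f x)%:E + \int[phi]_(x in A) (g x)%:E.
Proof.
move=> mA mf mg f0 g0; under eq_integral do rewrite EFinD.
apply: ge0_integralD => //; try by move=> x _; rewrite lee_fin.
- by apply/measurable_EFinP; exact: measurable_funTS.
- by apply/measurable_EFinP; exact: measurable_funTS.
Qed.

Lemma integral_densityZ (c : R) f A : measurable A -> measurable_fun setT f ->
  (forall x, 0 <= f x)%R -> (0 <= c)%R ->
  \int[phi]_(x in A) (c * f x)%:E = c%:E * \int[phi]_(x in A) (f x)%:E.
Proof.
move=> mA mf f0 c0; under eq_integral do rewrite EFinM.
apply: ge0_integralZl_EFin => //; first by move=> x _; rewrite lee_fin.
by apply/measurable_EFinP; exact: measurable_funTS.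
Qed.

End densities.

(** A Radon-Nikodym density is at most 1 only almost everywhere; truncating it at 1 gives the bound
    everywhere. *)
Lemma bounded_density d (X : measurableType d) (R : realType)
    (phi nu : {finite_measure set X -> \bar R}) :
  (forall A, measurable A -> nu A <= phi A) ->
  exists h : X -> R, [/\ measurable_fun setT h, forall x, (0 <= h x <= 1)%R &
    forall A, measurable A -> nu A = \int[phi]_(x in A) (h x)%:E].
Proof.
move=> nu_le.
have nu_ac : nu `<< phi.
  move=> A A0 B mB BA; apply/eqP; rewrite eq_le measure_ge0 andbT.
  by rewrite -(A0 _ mB BA) nu_le.
have [f0 [f0_ge0 f0_fin /integrableP[f0_meas _] f0E]] :=
  radon_nikodym_sigma_finite nu_ac.
pose f x := fine (f0 x).
have fE x : f0 x = (f x)%:E by rewrite fineK.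
have f_ge0 x : (0 <= f x)%R by rewrite -lee_fin -fE.
have mf : measurable_fun setT f.
  apply/measurable_EFinP; rewrite (_ : _ \o _ = f0)//.
  by apply/funext => x /=; rewrite -fE.
have {}f0E A : measurable A -> nu A = \int[phi]_(x in A) (f x)%:E.
  by move=> mA; rewrite f0E//; apply: eq_integral => x _; rewrite fE.
pose h x := Num.min (f x) 1%R.
have h_ge0 x : (0 <= h x)%R by rewrite le_min f_ge0 ler01.
have mh : measurable_fun setT h by exact: measurable_minr.
exists h; split=> // [x|A mA]; first by rewrite h_ge0/= ge_min lexx orbT.
pose E := [set x | 1 < f x]%R.
have mE : measurable E by exact: measurable_set_ltr.
have mAE : measurable (A `&` E) by exact: measurableI.
have mAE' : measurable (A `\` E) by exact: measurableD.
have split_int (g : X -> R) : measurable_fun setT g -> (forall x, 0 <= g x)%R ->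
    \int[phi]_(x in A) (g x)%:E =
    \int[phi]_(x in A `&` E) (g x)%:E + \int[phi]_(x in A `\` E) (g x)%:E.
  move=> mg g0; rewrite -ge0_integral_setU//=.
  - by rewrite setUIDK.
  - by apply/measurable_EFinP; exact: measurable_funTS.
  - by move=> x _; rewrite lee_fin.
  - by rewrite disj_set2E setIDA setIAC -setIDA setDv setI0.
rewrite f0E// !split_int//; congr (_ + _); last first.
  apply: eq_integral => x /set_mem[_ /negP]; rewrite -leNgt /h => f1.
  by rewrite min_l.
(* Where [f] exceeds 1, [h] is 1, so [nu <= phi] bounds the integral of [f] by that of [h]. *)
apply/eqP; rewrite eq_le; apply/andP; split.
  rewrite -f0E//; apply: (le_trans (nu_le _ mAE)).
  rewrite -[leLHS]mul1e -integral_cst//.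
  apply: (@le_integral_density _ _ _ phi (fun=> 1%R) h) => //.
  by move=> x [_ /ltW f1]; rewrite /h min_r.
by apply: le_integral_density => // x _; rewrite /h ge_min lexx.
Qed.

Lemma dcost_linear d (X : measurableType d) (R : realType) (c1 c2 : R)
    (m m1 m2 : set X -> \bar R) (B : nat -> set X) :
  (0 <= c1)%R -> (0 <= c2)%R ->
  (forall n, 0 <= m1 (B n)) -> (forall n, 0 <= m2 (B n)) ->
  (forall n, m (B n) = c1%:E * m1 (B n) + c2%:E * m2 (B n)) ->
  dcost m B = c1%:E * dcost m1 B + c2%:E * dcost m2 B.
Proof.
move=> c10 c20 m10 m20 mE.
rewrite /dcost -nneseriesZl// -nneseriesZl// -nneseriesD//.
- by apply: eq_eseriesr => n _; rewrite mE.
- by move=> n _ _; rewrite mule_ge0.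
- by move=> n _ _; rewrite mule_ge0.
Qed.

(** * The measure with density Z^a h^(1-a) *)

Section invariant_densities.
Context d (X : measurableType d) (R : realType) (S T : X -> X).
Hypotheses (SK : cancel S T) (TK : cancel T S) (mS : measurable_fun setT S).
Implicit Types (nu mu rho : {finite_measure set X -> \bar R}).

(* On the set where [g n < f + e], the density [f] is squeezed between the
   invariant density [g n] and [g n - e]; these sets exhaust the space. *)
Lemma inf_density_invariant (phi rho : {finite_measure set X -> \bar R})
    (f : X -> R) (g : nat -> X -> R) :
  measurable_fun setT f -> (forall n, measurable_fun setT (g n)) ->
  (forall x, 0 <= f x)%R -> (forall n x, f x <= g n x)%R ->
  (forall x (e : R), 0 < e -> exists n, g n x < f x + e)%R ->
  (forall n A, measurable A ->
    \int[phi]_(x in S @^-1` A) (g n x)%:E = \int[phi]_(x in A) (g n x)%:E) ->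
  (forall A, rho A = \int[phi]_(x in A) (f x)%:E) -> shift_invariant S rho.
Proof.
move=> mf mg f0 fg g_adh gS rhoE; apply: (ge_shift_invariant mS) => A mA.
apply/lee_addgt0Pr => e e0.
have phi_fin : phi setT \is a fin_num by exact: fin_num_measure.
(* The errors add up to at most c times the mass of [phi], hence to at most e; the 1 avoids division
   by zero. *)
pose c : R := (e / (fine (phi setT) + 1))%R.
have phi0 : (0 <= fine (phi setT))%R by rewrite fine_ge0.
have c0 : (0 < c)%R by rewrite divr_gt0//; lra.
pose E n := A `&` [set x | g n x < f x + c]%R.
have mE n : measurable (E n).
  apply: measurableI => //; apply: measurable_set_ltr => //.
  exact: measurable_funD.
have AE : A = \bigcup_n E n.
  apply/seteqP; split=> [x Ax|x [n _ []]//].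
  by have [n gx] := g_adh x c c0; exists n.
have mD n : measurable (seqDU E n) by apply: measurableD => //; exact: bigsetU_measurable.
have DE n : seqDU E n `<=` E n by exact: subDsetl.
have AD : A = \bigcup_n seqDU E n by rewrite -seqDU_bigcup_eq.
have tD := trivIset_seqDU E.
rewrite {1}AD preimage_bigcup.
have mSD n : measurable (S @^-1` seqDU E n) by exact: (measurable_preimageS mS).
apply: (@le_trans _ _ (\sum_(n <oo) rho (S @^-1` seqDU E n))).
  by apply: measure_sigma_subadditive => //; exact: bigcup_measurable.
apply: (@le_trans _ _ (\sum_(n <oo) (rho (seqDU E n) + c%:E * phi (seqDU E n)))).
  apply: lee_nneseries => // n _.
  rewrite rhoE; apply: (@le_trans _ _ (\int[phi]_(x in S @^-1` seqDU E n) (g n x)%:E)).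
    by apply: le_integral_density => // x _; exact: fg.
  rewrite gS// rhoE -integral_cst//.
  rewrite -(@integral_densityD _ _ _ phi f (fun=> c))//; last by move=> x; exact: ltW.
  apply: le_integral_density => //.
  - exact: measurable_funD.
  - by move=> x; exact: le_trans (f0 x) (fg n x).
  - by move=> x /DE[_ /ltW].
rewrite nneseriesD//; last by move=> n _ _; rewrite mule_ge0// lee_fin ltW.
rewrite nneseriesZl// -!measure_semi_bigcup -?AD//.
rewrite leeD2l//; apply: (@le_trans _ _ (c%:E * phi setT)).
  by rewrite lee_pmul2l// le_measure ?inE.
rewrite -(fineK phi_fin) -EFinM lee_fin /c mulrAC ler_pdivrMr; nra.
Qed.

End invariant_densities.

(** * The measure [rho] and its sums over nearly optimal covers *)

Section power_measure.
Context d (X : measurableType d) (R : realType) (S T : X -> X).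
Hypotheses (SK : cancel S T) (TK : cancel T S) (mS : measurable_fun setT S).
Variables phi Lambda nu : {finite_measure set X -> \bar R}.
Variables (Z h : X -> R) (a : R).
Hypotheses (LambdaS : shift_invariant S Lambda) (nuS : shift_invariant S nu).
Hypothesis nuE : forall A, nu A = douter T phi A.
Hypotheses (mZ : measurable_fun setT Z) (Z0 : forall x, (0 <= Z x)%R).
Hypothesis ZE : forall A, measurable A -> Lambda A = \int[phi]_(x in A) (Z x)%:E.
Hypotheses (mh : measurable_fun setT h) (h01 : forall x, (0 <= h x <= 1)%R).
Hypothesis hE : forall A, measurable A -> nu A = \int[phi]_(x in A) (h x)%:E.
Hypothesis a01 : (0 <= a <= 1)%R.

Let h0 x : (0 <= h x)%R. Proof. by have /andP[] := h01 x. Qed.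
Let h1 x : (h x <= 1)%R. Proof. by have /andP[] := h01 x. Qed.
Let a0 : (0 <= a)%R. Proof. by have /andP[] := a01. Qed.
Let a1 : (0 <= 1 - a)%R. Proof. by rewrite subr_ge0; have /andP[] := a01. Qed.

Definition mean_density x : R := (Z x `^ a * h x `^ (1 - a))%R.

Lemma measurable_mean_density : measurable_fun setT mean_density.
Proof.
apply: measurable_funM.
- exact: (measurableT_comp (@measurable_powR R a) mZ).
- exact: (measurableT_comp (@measurable_powR R (1 - a)) mh).
Qed.

Lemma mean_density_ge0 x : (0 <= mean_density x)%R.
Proof. by rewrite mulr_ge0// powR_ge0. Qed.

Lemma integral_weighted_sum (k : X -> R) u A : measurable_fun setT k ->
  (forall x, 0 <= k x)%R -> measurable A ->
  \int[phi]_(x in A) (weighted_sum a u (Z x) (k x))%:E =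
  (a * expR ((1 - a) * u))%:E * Lambda A +
  ((1 - a) * expR (- (a * u)))%:E * \int[phi]_(x in A) (k x)%:E.
Proof.
move=> mk k0 mA; rewrite ZE//.
have c1 : (0 <= a * expR ((1 - a) * u))%R by rewrite mulr_ge0// expR_ge0.
have c2 : (0 <= (1 - a) * expR (- (a * u)))%R by rewrite mulr_ge0// expR_ge0.
rewrite -!integral_densityZ// -integral_densityD//.
- by apply: measurable_funM.
- by apply: measurable_funM.
- by move=> x; rewrite mulr_ge0.
- by move=> x; rewrite mulr_ge0.
Qed.

Lemma measurable_weighted_sum (k : X -> R) u : measurable_fun setT k ->
  measurable_fun setT (fun x => weighted_sum a u (Z x) (k x)).
Proof. by move=> mk; apply: measurable_funD; apply: measurable_funM. Qed.

Lemma mean_measure : exists rho : {finite_measure set X -> \bar R},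
  (forall A, rho A = \int[phi]_(x in A) (mean_density x)%:E) /\
  shift_invariant S rho.
Proof.
have [|rho rhoE] := density_finite_measure (phi := phi)
    measurable_mean_density mean_density_ge0.
  (* Young's inequality at u = 0 gives the integrable bound a Z + (1-a) h. *)
  apply: (@le_lt_trans _ _ (\int[phi]_x (weighted_sum a 0 (Z x) (h x))%:E)).
    apply: le_integral_density => //.
    - exact: measurable_mean_density.
    - exact: measurable_weighted_sum.
    - exact: mean_density_ge0.
    - by move=> x _; exact: powR_le_weighted_sum.
  rewrite integral_weighted_sum// -hE// ltey_eq fin_numD.
  by rewrite !fin_numM// fin_num_measure.
exists rho; split=> //.
(* An enumeration of the rationals; numbers that encode none give the parameter 0. *)
pose u n : R := ratr (odflt 0%R (unpickle n : option rat)).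
apply: (@inf_density_invariant _ _ _ _ mS phi rho mean_density
  (fun n x => weighted_sum a (u n) (Z x) (h x))) => //.
- exact: measurable_mean_density.
- by move=> n; exact: measurable_weighted_sum.
- exact: mean_density_ge0.
- by move=> n x; exact: powR_le_weighted_sum.
- move=> x e e0; have [r re] := weighted_sum_rat_adherent a01 (Z0 x) (h0 x) e0.
  by exists (pickle r); rewrite /u pickleK.
- move=> n A mA; have mSA := measurable_preimageS mS mA.
  by rewrite !integral_weighted_sum// -!hE// LambdaS// nuS.
Qed.


Variable rho : {finite_measure set X -> \bar R}.
Hypothesis rhoE : forall A, rho A = \int[phi]_(x in A) (mean_density x)%:E.
Hypothesis rhoS : shift_invariant S rho.
Variable Q : set X.

Let L := fine (douter T Lambda Q).
Let P := fine (douter T phi Q).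
Let r := fine (douter T rho Q).

Let LE : douter T Lambda Q = L%:E. Proof. by rewrite fineK// douter_fin_num. Qed.
Let PE : douter T phi Q = P%:E. Proof. by rewrite fineK// douter_fin_num. Qed.
Let PE' : douter T nu Q = P%:E.
Proof. by rewrite (douter_idem nuE). Qed.
Let rE : douter T rho Q = r%:E. Proof. by rewrite fineK// douter_fin_num. Qed.
Let L0 : (0 <= L)%R. Proof. by rewrite fine_ge0// douter_ge0. Qed.
Let P0 : (0 <= P)%R. Proof. by rewrite fine_ge0// douter_ge0. Qed.

(** The pointwise bound is summed over a cover nearly optimal for [nu] and [Lambda] at once. *)
Lemma douter_mean_le_weighted_sum u : (r <= weighted_sum a u L P)%R.
Proof.
pose c1 := (a * expR ((1 - a) * u))%R.
pose c2 := ((1 - a) * expR (- (a * u)))%R.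
have c10 : (0 <= c1)%R by rewrite mulr_ge0// expR_ge0.
have c20 : (0 <= c2)%R by rewrite mulr_ge0// expR_ge0.
have c120 : (0 < c1 + c2 + 1)%R by lra.
apply/ler_addgt0Pr => e e0.
have e'0 : (0 < e / (c1 + c2 + 1))%R by rewrite divr_gt0.
have [B QB [nuB LB]] := good_dcover TK mS nu Q LambdaS e'0.
move: nuB LB (douter_le rho QB); rewrite LE PE' rE => nuB LB rB.
have costE : dcost (fun A => \int[phi]_(x in A) (weighted_sum a u (Z x) (h x))%:E) B =
    c1%:E * dcost Lambda B + c2%:E * dcost nu B.
  apply: dcost_linear => // n; have mBn := QB.1 n.
  by rewrite integral_weighted_sum// hE.
have : dcost rho B <= c1%:E * dcost Lambda B + c2%:E * dcost nu B.
  rewrite -costE; apply: le_dcost => n; first exact: measure_ge0.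
  rewrite rhoE; apply: le_integral_density.
  - exact: QB.1.
  - exact: measurable_mean_density.
  - exact: measurable_weighted_sum.
  - exact: mean_density_ge0.
  - by move=> x _; exact: powR_le_weighted_sum.
move: nuB LB rB (dcost_ge0 nu B) (dcost_ge0 Lambda B).
case: (dcost nu B) (dcost Lambda B) => [n||] [l||] //.
rewrite !lte_fin !lee_fin -!EFinM -EFinD => nP lL rB n0 l0 /(le_trans rB).
rewrite lee_fin => rle; apply: (le_trans rle).
rewrite /weighted_sum -/c1 -/c2.
set k := (e / _)%R in nP lL e'0.
have kE : (k * (c1 + c2 + 1) = e)%R by rewrite divfK// gt_eqF.
by have := ler_wpM2l c10 (ltW lL); have := ler_wpM2l c20 (ltW nP); lra.
Qed.

Lemma douter_mean_le : (r <= L `^ a * P `^ (1 - a))%R.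
Proof.
apply/ler_addgt0Pr => e e0; have [u ue] := weighted_sum_adherent a01 L0 P0 e0.
exact: le_trans (douter_mean_le_weighted_sum u) (ltW ue).
Qed.

(* A nearly minimal sum of [a Lambda + (1 - a) nu] has nearly minimal parts. *)
Let gap_density x := (a * Z x + (1 - a) * h x - mean_density x)%R.

Let gap_density_ge0 x : (0 <= gap_density x)%R.
Proof.
have := powR_le_weighted_sum 0 a01 (Z0 x) (h0 x).
by rewrite /weighted_sum !mulr0 oppr0 expR0 !mulr1 -/(mean_density x) subr_ge0.
Qed.

Let measurable_gap_density : measurable_fun setT gap_density.
Proof.
apply: measurable_funB; last exact: measurable_mean_density.
by apply: measurable_funD; apply: measurable_funM.
Qed.

Let gap_measure : exists tau : {finite_measure set X -> \bar R},
  (forall A, measurable A -> a%:E * Lambda A + (1 - a)%:E * nu A = rho A + tau A) /\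
  shift_invariant S tau.
Proof.
have E A : measurable A -> a%:E * Lambda A + (1 - a)%:E * nu A =
    rho A + \int[phi]_(x in A) (gap_density x)%:E.
  move=> mA; rewrite rhoE -integral_densityD//.
  - have := integral_weighted_sum 0 mh h0 mA.
    rewrite !mulr0 oppr0 expR0 !mulr1 -hE// => <-.
    apply: eq_integral => x _; congr (_%:E).
    by rewrite /weighted_sum !mulr0 oppr0 expR0 !mulr1 /gap_density; ring.
  - exact: measurable_mean_density.
  - exact: mean_density_ge0.
have finE A : measurable A -> a%:E * Lambda A + (1 - a)%:E * nu A \is a fin_num.
  by move=> mA; rewrite fin_numD !fin_numM// fin_num_measure.
have [|tau tauE] := density_finite_measure (phi := phi)
    measurable_gap_density gap_density_ge0.
  apply: (@le_lt_trans _ _ (rho setT + \int[phi]_x (gap_density x)%:E)).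
    by rewrite leeDr.
  by rewrite -E// ltey_eq finE.
exists tau; split=> [A mA|A mA]; first by rewrite E// tauE.
have mSA := measurable_preimageS mS mA.
(* As a difference of finite invariant measures, [tau] is invariant. *)
have tauB B : measurable B ->
    tau B = a%:E * Lambda B + (1 - a)%:E * nu B - rho B.
  by move=> mB; rewrite E// -tauE addeAC subee ?add0e// fin_num_measure.
by rewrite !tauB// LambdaS// nuS// rhoS.
Qed.

Let dcost_power B := dcost (fun A => \int[phi]_(x in A) (Z x `^ a)%:E) B.

(** The difference between Z^a, the density summed in J_a, and the density of [rho]. *)
Let excess_density x : R := (Z x `^ a * (1 - h x `^ (1 - a)))%R.

Let hpow01 x : (0 <= h x `^ (1 - a) <= 1)%R.
Proof.
rewrite powR_ge0/=; have := @ge0_ler_powR R (1 - a) a1 (h x) 1%R.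
by rewrite powR1; apply; rewrite ?nnegrE.
Qed.

Let excess_density_ge0 x : (0 <= excess_density x)%R.
Proof.
by rewrite mulr_ge0// ?powR_ge0// subr_ge0; have /andP[] := hpow01 x.
Qed.

Let measurable_powZ : measurable_fun setT (fun x => Z x `^ a)%R.
Proof. exact: (measurableT_comp (@measurable_powR R a) mZ). Qed.

Let measurable_excess_density : measurable_fun setT excess_density.
Proof.
apply: measurable_funM => //; apply: measurable_funB => //.
exact: (measurableT_comp (@measurable_powR R (1 - a)) mh).
Qed.

Let dcost_powerE B : (forall n, measurable (B n)) -> dcost_power B =
  dcost rho B + dcost (fun A => \int[phi]_(x in A) (excess_density x)%:E) B.
Proof.
move=> mB; rewrite /dcost_power /dcost -nneseriesD//; last first.
  by move=> n _ _; apply: integral_ge0 => x _; rewrite lee_fin.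
apply: eq_eseriesr => n _; rewrite rhoE -integral_densityD//.
- apply: eq_integral => x _; congr (_%:E).
  by rewrite /mean_density /excess_density -mulrDr addrC subrK mulr1.
- exact: measurable_mean_density.
- exact: mean_density_ge0.
Qed.

Let dcost_split_h B : (forall n, measurable (B n)) -> dcost phi B =
  dcost nu B + dcost (fun A => \int[phi]_(x in A) (1 - h x)%:E) B.
Proof.
move=> mB; rewrite /dcost -nneseriesD//; last first.
  by move=> n _ _; apply: integral_ge0 => x _; rewrite lee_fin subr_ge0.
apply: eq_eseriesr => n _; rewrite hE// -integral_densityD//.
- under eq_integral do rewrite addrC subrK.
  by rewrite integral_cst// mul1e.
- exact: measurable_funB.
- by move=> x; rewrite subr_ge0.
Qed.

(** For h in [0,1] one has 1 - h^(1-a) <= 1 - h <= (1-h)^(1-a). *)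
Let excess_le x : (a < 1)%R ->
  (excess_density x <= Z x `^ a * (1 - h x) `^ (1 - a))%R.
Proof.
move=> alt1; apply: ler_wpM2l; first exact: powR_ge0.
have pw y : (0 <= y <= 1)%R -> (y <= y `^ (1 - a))%R.
  move=> /andP[]; rewrite le_eqVlt => /predU1P[<- _|y0 y1].
    by rewrite powR_ge0.
  by apply: ger1_powR; [rewrite y0|rewrite lerBlDr lerDl a0].
have := pw _ (h01 x); have := pw (1 - h x)%R.
rewrite subr_ge0 h1 lerBlDr lerDl h0 => /(_ isT) h1_le h_le.
by lra.
Qed.

Lemma dcost_power_ge B : dcovers T Q B -> douter T rho Q <= dcost_power B.
Proof.
move=> QB; apply: (le_trans (douter_le rho QB)).
by rewrite dcost_powerE ?leeDl//; [apply: nneseries_ge0 => n _ _;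
  apply: integral_ge0 => x _; rewrite lee_fin|exact: QB.1].
Qed.

(** The [phi]-sum is below P + e0 while the [nu]-sum is at least P, so the sum of (1-h) [phi] is
    below e0. Young's inequality bounds the excess by c1 Z + c2 (1-h). *)
Lemma excess_small (e : R) : (0 < e)%R -> exists2 e0 : R, (0 < e0 <= 1)%R &
  forall B, dcovers T Q B ->
    dcost phi B < (P + e0)%:E -> dcost Lambda B < (L + e0)%:E ->
    dcost (fun A => \int[phi]_(x in A) (excess_density x)%:E) B <= e%:E.
Proof.
move=> e_gt0; have [aE|a_neq1] := eqVneq a 1%R.
  exists 1%R; first by rewrite ltr01 lexx.
  move=> B _ _ _; rewrite /dcost eseries0 ?lee_fin ?ltW// => n _ _.
  apply: integral0_eq => x _.
  by rewrite /excess_density aE subrr powRr0 subrr mulr0.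
have alt1 : (a < 1)%R by rewrite lt_neqAle a_neq1; have /andP[] := a01.
have L10 : (0 <= L + 1)%R by rewrite addr_ge0.
(* At y = 0 and a < 1 the infimum over u is 0, so some u makes c1 (L + 1) less than e / 2. Only then
   is e0 chosen, small compared with c2; the 1 allows for e0 <= 1. *)
have [|u] := @weighted_sum_adherent R a (L + 1)%R 0%R (e / 2) a01 L10 (lexx _).
  by rewrite divr_gt0.
rewrite [X in (_ * X + _)%R]powR0; last by rewrite gt_eqF// subr_gt0.
rewrite /weighted_sum !mulr0 addr0 add0r.
set c1 := (a * _)%R => c1e.
pose c2 := ((1 - a) * expR (- (a * u)))%R.
have c10 : (0 <= c1)%R by rewrite mulr_ge0// expR_ge0.
have c20 : (0 <= c2)%R by rewrite mulr_ge0// expR_ge0.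
pose e0 := Num.min 1%R (e / 2 / (c2 + 1))%R.
have e0_gt0 : (0 < e0)%R.
  by rewrite lt_min ltr01 divr_gt0//; lra.
have e0_le1 : (e0 <= 1)%R by rewrite ge_min lexx.
have e0_le : (c2 * e0 <= e / 2)%R.
  apply: (@le_trans _ _ ((c2 + 1) * e0)%R); first by rewrite ler_wpM2r//; lra.
  have c2p : (0 < c2 + 1)%R by lra.
  by rewrite mulrC -ler_pdivlMr// ge_min lexx orbT.
exists e0; first by rewrite e0_gt0.
move=> B QB phiB LB; have [mB _] := QB.
have ge0 n : 0 <= \int[phi]_(x in B n) (1 - h x)%:E.
  by apply: integral_ge0 => x _; rewrite lee_fin subr_ge0.
have m1h : measurable_fun setT (fun x => 1 - h x)%R by exact: measurable_funB.
have h1_ge0 x : (0 <= 1 - h x)%R by rewrite subr_ge0.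
apply: (@le_trans _ _ (c1%:E * dcost Lambda B +
    c2%:E * dcost (fun A => \int[phi]_(x in A) (1 - h x)%:E) B)).
  rewrite -(@dcost_linear _ _ _ c1 c2 (fun A =>
    \int[phi]_(x in A) (weighted_sum a u (Z x) (1 - h x))%:E))//; last first.
    by move=> n; rewrite integral_weighted_sum.
  apply: le_dcost => n.
    by apply: integral_ge0 => x _; rewrite lee_fin.
  apply: le_integral_density => //; first exact: measurable_weighted_sum.
  move=> x _; apply: (le_trans (excess_le x alt1)).
  exact: powR_le_weighted_sum.
move: phiB LB (douter_le nu QB) (dcost_ge0 nu B) (dcost_ge0 Lambda B).
rewrite dcost_split_h// PE'.
set dx := dcost (fun A => \int[phi]_(x in A) (1 - h x)%:E) B.
have : 0 <= dx by exact: nneseries_ge0.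
case: dx (dcost nu B) (dcost Lambda B) => [x||] [n||] [l||] //.
rewrite -!EFinM -!EFinD !lte_fin !lee_fin => x0 nP lL Pn n0 l0.
have := ler_wpM2l c10 (ltW lL); have x_le : (x <= e0)%R by lra.
have := ler_wpM2l c20 x_le; have := ler_wpM2l c10 e0_le1.
by rewrite !mulrDr in c1e *; lra.
Qed.

Lemma dcost_power_le (e : R) : (0 < e)%R -> exists2 e0 : R, (0 < e0)%R &
  forall B, dcovers T Q B ->
    dcost phi B < (P + e0)%:E -> dcost Lambda B < (L + e0)%:E ->
    dcost_power B <= (r + e)%:E.
Proof.
move=> e_gt0; have [tau [tauE tauS]] := gap_measure.
pose t := fine (douter T tau Q).
have tE : douter T tau Q = t%:E by rewrite fineK// douter_fin_num.
(* On a cover nearly optimal for [tau] and [rho], the sum of a [Lambda] + (1-a) [nu] is below r + t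
   + x and at least a L + (1-a) P. *)
have sum_le : (a * L + (1 - a) * P <= r + t)%R.
  apply/ler_addgt0Pr => x x0; have x20 : (0 < x / 2)%R by rewrite divr_gt0.
  have [B1 QB1 [tauB1 rhoB1]] := good_dcover TK mS tau Q rhoS x20.
  (* Intersecting with the trivial cover makes all sums finite. *)
  have QB0 : dcovers T Q (fun n => if n is 0%N then setT else set0).
    by split=> [[|n]//|y _]; exists 0%N.
  have [B QB costB] := common_dcover R TK mS QB1 QB0.
  have tauB := le_lt_trans (costB _ tauS).1 tauB1.
  have rhoB := le_lt_trans (costB _ rhoS).1 rhoB1.
  have fin_dcost (mu : {finite_measure set X -> \bar R}) :
      shift_invariant S mu -> dcost mu B \is a fin_num.
    move=> muS; rewrite ge0_fin_numE ?dcost_ge0//.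
    apply: le_lt_trans (costB _ muS).2 _.
    by rewrite dcost_single ltey_eq (fin_num_measure mu _ measurableT).
  have := @dcost_linear _ _ _ a (1 - a)
    (fun A => rho A + tau A) Lambda nu B a0 a1
    (fun n => measure_ge0 _ _) (fun n => measure_ge0 _ _)
    (fun n => esym (tauE _ (QB.1 n))).
  rewrite {1}/dcost nneseriesD// -/(dcost _ _) -/(dcost _ _).
  move: tauB rhoB (douter_le Lambda QB) (douter_le nu QB).
  rewrite tE rE LE PE' -!EFinD.
  have := dcost_ge0 tau B; have := dcost_ge0 rho B.
  case: (dcost tau B) (dcost rho B) => [y||] [z||] //.
  move: (fin_dcost _ LambdaS) (fin_dcost _ nuS).
  case: (dcost Lambda B) (dcost nu B) => [l||] [n||] // _ _.
  rewrite -!EFinM -!EFinD !lee_fin !lte_fin => z0 y0 yt zr Ll Pn [] sumE.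
  have := ler_wpM2l a0 Ll; have := ler_wpM2l a1 Pn; lra.
have e20 : (0 < e / 2)%R by rewrite divr_gt0.
have [e0 /andP[e0_gt0 e0_le1] excessP] := excess_small e20.
(* Half of e pays for the excess, half for the [rho]-sum: the latter is the sum of a [Lambda] +
   (1-a) [nu], at most a L + (1-a) P + e1, minus the [tau]-sum, at least t. *)
pose e1 := Num.min e0 (e / 2)%R.
have e1_le0 : (e1 <= e0)%R by rewrite ge_min lexx.
have e1_le : (e1 <= e / 2)%R by rewrite ge_min lexx orbT.
exists e1; first by rewrite lt_min e0_gt0.
move=> B QB phiB LB.
have [mB _] := QB; rewrite dcost_powerE// (splitr e) addrA EFinD.
apply: leeD; last first.
  by apply: (excessP _ QB); [apply: lt_le_trans phiB _|apply: lt_le_trans LB _];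
    rewrite lee_fin lerD2l.
have := @dcost_linear _ _ _ a (1 - a)
  (fun A => rho A + tau A) Lambda nu B a0 a1
  (fun n => measure_ge0 _ _) (fun n => measure_ge0 _ _)
  (fun n => esym (tauE _ (mB n))).
rewrite {1}/dcost nneseriesD// -/(dcost _ _) -/(dcost _ _).
have : dcost nu B <= dcost phi B.
  rewrite dcost_split_h// leeDl//; apply: nneseries_ge0 => n _ _.
  by apply: integral_ge0 => x _; rewrite lee_fin subr_ge0.
move=> /le_lt_trans/(_ phiB){phiB}.
move: LB (douter_le tau QB); rewrite tE.
have := dcost_ge0 rho B; have := dcost_ge0 nu B; have := dcost_ge0 Lambda B.
case: (dcost nu B) (dcost Lambda B) => [n||] [l||] //.
case: (dcost tau B) (dcost rho B) => [y||] [z||] //.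
rewrite -!EFinM -!EFinD !lee_fin !lte_fin => l0 n0 z0 lL ty nP [] sumE.
have := ler_wpM2l a0 (ltW lL); have := ler_wpM2l a1 (ltW nP).
by rewrite !mulrDr mulrBl mul1r; lra.
Qed.

End power_measure.

(** * Back to the sequences (A_m) *)

Lemma lim_at_right0 (R : realType) (f : R -> \bar R) (r : R) :
  (forall e : R, (0 < e)%R -> exists2 e0 : R, (0 < e0)%R &
     forall x : R, (0 < x < e0)%R -> (r - e)%:E <= f x <= (r + e)%:E) ->
  lim (f x @[x --> (0 : R)^'+]) = r%:E.
Proof.
move=> fr; apply/cvg_lim => //; apply/fine_cvgP; split.
  have [e0 e0_gt0 fe0] := fr _ ltr01.
  near=> x; have /andP[] : (r - 1)%:E <= f x <= (r + 1)%:E.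
    by apply: fe0; apply/andP; split; near: x;
      [exact: nbhs_right_gt|exact: nbhs_right_lt].
  by case: (f x).
apply/cvgrPdist_le => e e_gt0; have [e0 e0_gt0 fe0] := fr _ e_gt0.
near=> x; have : (r - e)%:E <= f x <= (r + e)%:E.
  by apply: fe0; apply/andP; split; near: x;
    [exact: nbhs_right_gt|exact: nbhs_right_lt].
rewrite /=; case: (f x) => [y||] /andP[]; rewrite ?lee_fin//= => ly yu.
by rewrite ler_norml; apply/andP; split; lra.
Unshelve. all: by end_near. Qed.

Lemma sub_sigma_algebra_generated (X : Type) (G F : set (set X)) :
  G `<=` F -> F set0 -> (forall A, F A -> F (~` A)) ->
  (forall A : nat -> set X, (forall n, F (A n)) -> F (\bigcup_n A n)) ->
  <<s G >> `<=` F.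
Proof.
move=> GF F0 FC FU; apply: smallest_sub => //.
by split=> // A FA; rewrite setTD; exact: FC.
Qed.

Section dynamical_encoding.
Context (R : realType) (X : pointedType) (S T : X -> X) (cA : set (set X)).
Hypotheses (SK : cancel S T) (TK : cancel T S).

Lemma powset_image n A : powset S n%:Z A = iter n T @^-1` A.
Proof.
apply/seteqP; split=> x.
  by move=> [y Ay <-]; rewrite /preimage/= (iter_can _ SK).
by move=> Ax; exists (iter n T x) => //; rewrite (iter_can _ TK).
Qed.

Lemma powset_preimage n A : powset S (- n%:Z) A = iter n S @^-1` A.
Proof. by case: n => [|n] //; rewrite powset_image. Qed.

Lemma measurable_S : measurable_fun [set: space0 S cA] (S : space0 S cA -> space0 S cA).
Proof.
move=> _ Y mY; rewrite setTI; move: Y mY.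
apply: sub_sigma_algebra_generated.
- move=> _ [n _ [A cAA <-]]; apply: sub_sigma_algebra; exists n.+1 => //.
  exists A => //; rewrite !powset_preimage.
  by apply/seteqP; split=> x; rewrite /preimage/= -iterSr.
- by rewrite /= preimage_set0; exact: measurable0.
- by move=> A /= mA; rewrite -preimage_setC; exact: measurableC.
- by move=> A /= mA; rewrite preimage_bigcup; exact: bigcup_measurable.
Qed.

Let X0 := space0 S cA.
Let SK0 : cancel (S : X0 -> X0) (T : X0 -> X0) := SK.
Let TK0 : cancel (T : X0 -> X0) (S : X0 -> X0) := TK.
Let unshift (A : nat -> set X) n : set X0 := powset S (- n%:Z) (A n).

Lemma covers_unshift Q A : covers S cA Q A <-> dcovers (T : X0 -> X0) Q (unshift A).
Proof.
have AE n : iter n T @^-1` unshift A n = A n.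
  rewrite /unshift powset_preimage.
  by apply/seteqP; split=> x; rewrite /preimage/= (iter_can _ TK).
split=> [[Am QA]|[mA QA]]; split.
- move=> n; rewrite /unshift; have [B mB <-] := Am n.
  rewrite powset_preimage powset_image.
  rewrite (_ : _ @^-1` _ = B)//.
  by apply/seteqP; split=> x; rewrite /preimage/= (iter_can _ SK).
- by move=> x /QA[n _ Ax]; exists n => //; rewrite AE.
- by move=> n; exists (unshift A n) => //; rewrite powset_image.
- by move=> x /QA[n _ Ax]; exists n => //; rewrite -AE.
Qed.

Lemma unshift_surjective (B : nat -> set X0) :
  exists A, unshift A = B.
Proof.
exists (fun n => powset S n%:Z (B n)); apply/funext => n.
rewrite /unshift powset_preimage powset_image.
by apply/seteqP; split=> x; rewrite /preimage/= (iter_can _ SK).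
Qed.

Lemma dynsum_unshift (nu : set X0 -> \bar R) A : dynsum S nu A = dcost nu (unshift A).
Proof. by []. Qed.

(** Every sequence arises as some (S^m A_m), so both families have the same set of sums; this serves
    infima and suprema alike. *)
Lemma image_dynsum (nu : set X0 -> \bar R) (F : set (nat -> set X))
    (G : set (nat -> set X0)) :
  (forall A, F A <-> G (unshift A)) ->
  [set dynsum S nu A | A in F] = [set dcost nu B | B in G].
Proof.
move=> FG; apply/seteqP; split=> [_ [A /FG GA <-]|_ [B + <-]].
  by exists (unshift A).
have [A <-] := unshift_surjective B => /FG FA; by exists A.
Qed.

Lemma dynouterE (nu : set X0 -> \bar R) Q :
  dynouter S cA nu Q = douter (T : X0 -> X0) nu Q.
Proof. by rewrite /dynouter (image_dynsum _ (covers_unshift Q)). Qed.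

Variables phi0 Lambda : {finite_measure set X0 -> \bar R}.
Hypothesis LambdaS : shift_invariant (S : X0 -> X0) Lambda.

Let good e Q (B : nat -> set X0) := [/\ dcovers (T : X0 -> X0) Q B,
  dcost phi0 B < douter (T : X0 -> X0) phi0 Q + e%:E &
  dcost Lambda B < douter (T : X0 -> X0) Lambda Q + e%:E].

Lemma dynouter1E Q : dynouter1 S cA Lambda phi0 Q = douter (T : X0 -> X0) phi0 Q.
Proof.
have phiQ := douter_fin_num (T : X0 -> X0) phi0 Q.
rewrite -(fineK phiQ); apply: lim_at_right0 => e e_gt0.
exists 1%R => // x /andP[x_gt0 _].
rewrite (@image_dynsum phi0 _ [set B | dcovers (T : X0 -> X0) Q B /\
    dcost Lambda B < douter (T : X0 -> X0) Lambda Q + x%:E]); last first.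
  move=> A; rewrite /covers1/= dynouterE dynsum_unshift.
  by split=> -[/covers_unshift ? ?].
apply/andP; split.
  apply/le_ereal_inf_tmp => _ [B [QB _] <-].
  by apply: le_trans (douter_le phi0 QB); rewrite EFinD fineK// geeDl// lee_fin oppr_le0 ltW.
(* The bound by x meets the constraint on the [Lambda]-sum, the bound by e gives the accuracy. *)
pose y := Num.min x e.
have y_gt0 : (0 < y)%R by rewrite lt_min x_gt0.
have [B QB [phiB LB]] := good_dcover TK0 measurable_S phi0 Q LambdaS y_gt0.
apply: (@le_trans _ _ (dcost phi0 B)).
  apply: ereal_inf_lbound; exists B => //; split=> //.
  by apply: lt_le_trans LB _; rewrite leeD2l// lee_fin ge_min lexx.
apply: (le_trans (ltW phiB)).
by rewrite EFinD fineK// leeD2l// lee_fin ge_min lexx orbT.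
Qed.

Lemma covers01_good e Q A : covers01 S cA Lambda phi0 e Q A <-> good e Q (unshift A).
Proof.
rewrite /covers01 /covers1/= dynouter1E dynouterE !dynsum_unshift.
by split=> [[[/covers_unshift ? ?] ?]|[/covers_unshift ? ? ?]].
Qed.

(** The Caratheodory sets form a sigma-algebra, so the generators of B suffice: preimages under
    powers of [S] lie in A_0, and images are handled by invariance. *)
Lemma caratheodory_spaceB (rho : {finite_measure set X0 -> \bar R}) :
  shift_invariant (S : X0 -> X0) rho ->
  exists mu : {finite_measure set (spaceB S cA) -> \bar R},
    forall Q, mu Q = douter (T : X0 -> X0) rho Q.
Proof.
move=> rhoS.
pose out : {outer_measure set X0 -> \bar R} := douter (T : X0 -> X0) rho.
apply: (@caratheodory_finite_measure _ (spaceB S cA) R out).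
  apply: sub_sigma_algebra_generated.
  - have mcA n A : cA A -> measurable (iter n S @^-1` A : set X0).
      move=> cAA; apply: sub_sigma_algebra; exists n => //.
      by exists A => //; rewrite powset_preimage.
    move=> _ [[n|n] _ [A cAA <-]].
      rewrite powset_preimage.
      exact (douter_caratheodory TK0 measurable_S rho (mcA n A cAA)).
    rewrite NegzE opprK powset_image.
    exact (douter_invariant_caratheodory SK0 TK0 measurable_S n.+1 rhoS (mcA 0%N A cAA)).
  - exact: caratheodory_measurable_set0.
  - exact: caratheodory_measurable_setC.
  - exact: caratheodory_measurable_bigcup.
exact: (douter_lty (T : X0 -> X0) rho setT).
Qed.


Variables (Z : X0 -> R) (a : R).
Hypotheses (mZ : measurable_fun setT Z) (Z0 : forall x, (0 <= Z x)%R).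
Hypothesis ZE : forall A, measurable A -> Lambda A = \int[phi0]_(x in A) (Z x)%:E.
Hypothesis a01 : (0 <= a <= 1)%R.

Let powZ (D : set X0) : \bar R := \int[phi0]_(x in D) (Z x `^ a)%:E.

(** Collects what the evaluation of J_a and N_a uses, hiding [nu] and [h]. The lower bound holds for
    every cover, the upper bound for nearly optimal ones. *)
Lemma exists_power_measure : exists rho : {finite_measure set X0 -> \bar R},
  [/\ shift_invariant (S : X0 -> X0) rho,
   forall Q, (fine (douter (T : X0 -> X0) rho Q) <=
      fine (douter (T : X0 -> X0) Lambda Q) `^ a *
      fine (douter (T : X0 -> X0) phi0 Q) `^ (1 - a))%R,
   forall Q B, dcovers (T : X0 -> X0) Q B ->
     douter (T : X0 -> X0) rho Q <= dcost powZ B &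
   forall Q (e : R), (0 < e)%R -> exists2 e0 : R, (0 < e0)%R &
     forall B, good e0 Q B -> dcost powZ B <= douter (T : X0 -> X0) rho Q + e%:E].
Proof.
have [nu [nuE nuS nu_le]] := douter_restriction TK0 measurable_S phi0.
have [h [mh h01 hE]] := bounded_density nu_le.
have [rho [rhoE rhoS]] :=
  mean_measure measurable_S LambdaS nuS mZ Z0 ZE mh h01 hE a01.
exists rho; split => //.
- move=> Q; exact: (douter_mean_le TK0 measurable_S LambdaS nuE mZ Z0 ZE mh h01 hE a01 rhoE Q).
- move=> Q B QB; exact: (dcost_power_ge mZ mh h01 a01 rhoE QB).
- move=> Q e e_gt0.
  have [e0 e0_gt0 e0P] := dcost_power_le TK0 measurable_S LambdaS nuS nuE mZ Z0 ZE mh h01 hE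
    a01 rhoE rhoS Q e_gt0.
  exists e0 => // B [QB phiB LB].
  have := e0P B QB; rewrite !EFinD !fineK ?douter_fin_num//.
  by move=> /(_ phiB LB).
Qed.

(** * Evaluation of J_a and N_a *)

Section values.
Variable rho : {finite_measure set X0 -> \bar R}.
Hypothesis rho_ge : forall Q B, dcovers (T : X0 -> X0) Q B ->
  douter (T : X0 -> X0) rho Q <= dcost powZ B.
Hypothesis rho_le : forall Q (e : R), (0 < e)%R -> exists2 e0 : R, (0 < e0)%R &
  forall B, good e0 Q B -> dcost powZ B <= douter (T : X0 -> X0) rho Q + e%:E.

Let le_good Q (e e' : R) B : (e <= e')%R -> good e Q B -> good e' Q B.
Proof.
move=> ee' [QB phiB LB]; split => //; [apply: lt_le_trans phiB _|
  apply: lt_le_trans LB _]; by rewrite leeD2l// lee_fin.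
Qed.

Let exists_good Q (e : R) : (0 < e)%R -> exists B, good e Q B.
Proof.
move=> e_gt0.
have [B QB [phiB LB]] := good_dcover TK0 measurable_S phi0 Q LambdaS e_gt0.
by exists B; split.
Qed.

Lemma JfunE Q : Jfun Lambda phi0 Z a Q = douter (T : X0 -> X0) rho Q.
Proof.
have rhoQ := douter_fin_num (T : X0 -> X0) rho Q.
rewrite -(fineK rhoQ); apply: lim_at_right0 => e e_gt0.
have [e0 e0_gt0 e0P] := rho_le Q e_gt0.
exists e0 => // x /andP[x_gt0 xe0].
rewrite (@image_dynsum powZ _ (good x Q)); last by move=> A; exact: covers01_good.
(* Some good cover is needed to bound the supremum from below. *)
have [B Bx] := exists_good Q x_gt0.
apply/andP; split.
  apply: (@le_trans _ _ (dcost powZ B)).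
    by case: Bx => QB _ _; apply: le_trans (rho_ge QB);
      rewrite EFinD fineK// geeDl// lee_fin oppr_le0 ltW.
  by apply: ereal_sup_ubound; exists B.
apply: ge_ereal_sup => _ [C Cx <-]; rewrite EFinD fineK//; apply: e0P.
exact: le_good (ltW xe0) Cx.
Qed.

Let young_ge0 x : (0 <= a * Z x + 1 - a - Z x `^ a)%R.
Proof.
have := powR_le_weighted_sum 0 a01 (Z0 x) ler01.
by rewrite /weighted_sum powR1 !mulr0 oppr0 expR0 !mulr1 subr_ge0 addrA.
Qed.

Let mpowZ : measurable_fun setT (fun x => Z x `^ a)%R.
Proof. exact: (measurableT_comp (@measurable_powR R a) mZ). Qed.

Let young (D : set X0) : \bar R :=
  \int[phi0]_(x in D) (a * Z x + 1 - a - Z x `^ a)%:E.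

Let young_dcost B : (forall n, measurable (B n)) ->
  a%:E * dcost Lambda B + (1 - a)%:E * dcost phi0 B = dcost young B + dcost powZ B.
Proof.
move=> mB; have /andP[a0 a1] := a01.
rewrite -(@dcost_linear _ _ _ a (1 - a) (fun D => young D + powZ D))//.
- rewrite /dcost nneseriesD// => n _ _; apply: integral_ge0 => x _.
    by rewrite lee_fin.
  by rewrite lee_fin powR_ge0.
- by rewrite subr_ge0.
move=> n; rewrite ZE// /young /powZ -integral_densityD//.
- rewrite -integral_densityZ// -[X in _ + _ * X]mul1e -integral_cst//.
  rewrite -integral_densityZ ?subr_ge0// -integral_densityD//.
  - by apply: eq_integral => x _; congr (_%:E); rewrite /cst; ring.
  - exact: measurable_funM.
  - by move=> x; rewrite mulr_ge0.
  - by move=> x; rewrite mulr_ge0// subr_ge0.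
- by apply: measurable_funB => //; apply: measurable_funB => //;
    apply: measurable_funD => //; exact: measurable_funM.
- by move=> x; rewrite powR_ge0.
Qed.

(** The integrands of N_a and J_a add up to a Z + 1 - a, so on a good cover the sum for N_a is
    determined by three sums that are known up to small errors. *)
Lemma NfunE Q : Nfun Lambda phi0 Z a Q =
  a%:E * douter (T : X0 -> X0) Lambda Q +
  (1 - a)%:E * douter (T : X0 -> X0) phi0 Q - douter (T : X0 -> X0) rho Q.
Proof.
have /andP[a0 a1'] := a01; have a1 : (0 <= 1 - a)%R by rewrite subr_ge0.
pose L := fine (douter (T : X0 -> X0) Lambda Q).
pose P := fine (douter (T : X0 -> X0) phi0 Q).
pose r := fine (douter (T : X0 -> X0) rho Q).
have LE : douter (T : X0 -> X0) Lambda Q = L%:E by rewrite fineK// douter_fin_num.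
have PE : douter (T : X0 -> X0) phi0 Q = P%:E by rewrite fineK// douter_fin_num.
have rE : douter (T : X0 -> X0) rho Q = r%:E by rewrite fineK// douter_fin_num.
rewrite LE PE rE.
apply: (@lim_at_right0 _ _ (a * L + (1 - a) * P - r)%R) => e e_gt0.
have [e0 e0_gt0 e0P] := rho_le Q e_gt0.
(* [e0] controls the sum of Z^a, and e bounds the error a x + (1-a) x = x of the two other sums. *)
exists (Num.min e0 e); first by rewrite lt_min e0_gt0.
move=> x; rewrite lt_min => /andP[x_gt0 /andP[xe0 xe]].
rewrite (@image_dynsum young _ (good x Q)); last by move=> A; exact: covers01_good.
have bounds B : good x Q B ->
    (a * L + (1 - a) * P - r - e)%:E <= dcost young B <=
    (a * L + (1 - a) * P - r + e)%:E.
  move=> Bx; have := e0P _ (le_good (ltW xe0) Bx).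
  case: Bx => QB; rewrite PE LE => phiB LB.
  move: (rho_ge QB) (young_dcost QB.1); rewrite rE.
  move: phiB LB (douter_le phi0 QB) (douter_le Lambda QB); rewrite PE LE.
  have : 0 <= dcost young B.
    by apply: nneseries_ge0 => n _ _; apply: integral_ge0 => y _; rewrite lee_fin.
  case: (dcost phi0 B) (dcost Lambda B) => [p||] [l||] //.
  case: (dcost young B) (dcost powZ B) => [y||] [z||] //.
  rewrite -!EFinM -!EFinD !lte_fin !lee_fin => y0 pP lL Pp Ll rz [] sumE zr.
  have := ler_wpM2l a0 Ll; have := ler_wpM2l a1 Pp.
  have := ler_wpM2l a0 (ltW lL); have := ler_wpM2l a1 (ltW pP).
  by rewrite !mulrDr => *; apply/andP; split; lra.
have [B Bx] := exists_good Q x_gt0.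
apply/andP; split.
  by apply/le_ereal_inf_tmp => _ [C /bounds/andP[Cle _] <-].
apply: (@le_trans _ _ (dcost young B)); last by have /andP[] := bounds B Bx.
by apply: ereal_inf_lbound; exists B.
Qed.

End values.

End dynamical_encoding.

Theorem lemma27 (R : realType) (X : pointedType) (S : X -> X)
  (cA : set (set X))
  (phi0 Lambda : {finite_measure set (space0 S cA) -> \bar R})
  (Z : space0 S cA -> R)
  (S_bij : bijective S)
  (cA_sigma : sigma_algebra [set: X] cA)
  (Lambda_inv : forall A : set (space0 S cA), measurable A ->
     Lambda (S @^-1` A) = Lambda A)
  (Lambda_ac : Lambda `<< phi0)
  (Z_meas : measurable_fun [set: space0 S cA] Z)
  (Z_ge0 : forall x, (0 <= Z x)%R)
  (Z_density : forall A : set (space0 S cA), measurable A ->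
     Lambda A = \int[phi0]_(x in A) (Z x)%:E) :
  [/\ (* (i) *)
      forall alpha : R, (0 <= alpha <= 1)%R ->
        forall Q : set (spaceB S cA), measurable Q ->
          Jfun Lambda phi0 Z alpha Q <=
            dynouter S cA phi0 Q `^ (1 - alpha) *
            dynouter S cA Lambda Q `^ alpha,
      (* (ii) *)
      forall alpha : R, (0 < alpha <= 1)%R ->
        forall Q : set (spaceB S cA), measurable Q ->
          Nfun Lambda phi0 Z alpha Q =
            alpha%:E * dynouter S cA Lambda Q
            + (1 - alpha)%:E * dynouter S cA phi0 Q
            - Jfun Lambda phi0 Z alpha Q
    & (* (iii) *)
      forall alpha : R, (0 <= alpha <= 1)%R ->
        exists mu : {finite_measure set (spaceB S cA) -> \bar R},
          (forall Q : set (spaceB S cA), measurable Q ->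
             mu Q = Jfun Lambda phi0 Z alpha Q) /\
          (forall Q : set (spaceB S cA), measurable Q ->
             mu (S @^-1` Q) = mu Q)].

Proof.
have [T SK TK] := S_bij.
split=> [a a01 Q _|a /andP[a0 a1] Q _|a a01].
- have [rho [rhoS rhoQ rho_ge rho_le]] :=
    exists_power_measure SK TK Lambda_inv Z_meas Z_ge0 Z_density a01.
  rewrite (JfunE SK TK Lambda_inv rho_ge rho_le) !(dynouterE SK TK).
  have fin (nu : {finite_measure set (space0 S cA) -> \bar R}) :=
    douter_fin_num (T : space0 S cA -> space0 S cA) nu Q.
  rewrite -(fineK (fin rho)) -(fineK (fin phi0)) -(fineK (fin Lambda)).
  by rewrite !poweR_EFin -EFinM lee_fin mulrC; exact: rhoQ.
- have a01 : (0 <= a <= 1)%R by rewrite ltW.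
  have [rho [rhoS rhoQ rho_ge rho_le]] :=
    exists_power_measure SK TK Lambda_inv Z_meas Z_ge0 Z_density a01.
  rewrite (JfunE SK TK Lambda_inv rho_ge rho_le) !(dynouterE SK TK).
  exact: (NfunE SK TK Lambda_inv Z_meas Z_ge0 Z_density a01 rho_ge rho_le).
- have [rho [rhoS rhoQ rho_ge rho_le]] :=
    exists_power_measure SK TK Lambda_inv Z_meas Z_ge0 Z_density a01.
  (* [mu] agrees with the outer measure of [rho] on all subsets and inherits its invariance. *)
  have [mu muE] := caratheodory_spaceB SK TK rhoS.
  exists mu; split=> Q _; rewrite !muE.
    by rewrite (JfunE SK TK Lambda_inv rho_ge rho_le).
  have SK0 : cancel (S : space0 S cA -> space0 S cA) (T : space0 S cA -> space0 S cA) := SK.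
  have TK0 : cancel (T : space0 S cA -> space0 S cA) (S : space0 S cA -> space0 S cA) := TK.
  exact: (douter_shift SK0 TK0 (measurable_S SK TK) Q rhoS).
Qed.
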